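(* Let $K\subseteq\mathcal{S}(\mathbb{R}^+)$ be a bounded set in $L^2(\mathbb{R}^+)$. If $$\lim_{\xi\to+\infty}\ \sup_{f\in K}\int_{(\mathbb{R}\times\mathbb{R}^+)\setminus\left([-\xi,\xi]\times\left[\frac1\xi,\xi\right]\right)}|W_{\mathrm{Aff}}f(\omega,r)|\,d\omega\,\frac{dr}{r}=0,$$ then $K$ is relatively compact in $L^2(\mathbb{R}^+)$.
   Context: Functions are complex-valued. $\mathbb{R}^+=(0,+\infty)$ and $L^2(\mathbb{R}^+)=L^2(\mathbb{R}^+,r^{-1}dr)$ is the space of measurable functions on $\mathbb{R}^+$ that are square integrable with respect to the Haar measure $r^{-1}dr$. $\mathcal{S}(\mathbb{R}^+)$ is the space of functions $f:\mathbb{R}^+\to\mathbb{C}$ such that $x\mapsto f(e^x)$ belongs to the Schwartz space $\mathcal{S}(\mathbb{R})$. The affine Wigner distribution of $f$ is $$W_{\mathrm{Aff}}f(\omega,r)=\int_{-\infty}^{+\infty}f\left(\frac{rue^u}{e^u-1}\right)\overline{f\left(\frac{ru}{e^u-1}\right)}e^{-2\pi i\omega u}\,du,\qquad(\omega,r)\in\mathbb{R}\times\mathbb{R}^+.$$ *)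

(* Defs.v *)
From HB Require Import structures.
From mathcomp Require Import all_boot all_order all_algebra.
From mathcomp Require Import all_classical all_reals all_analysis.
From mathcomp Require Import measurable_realfun.
From mathcomp Require Import complex.

Set Implicit Arguments.
Unset Strict Implicit.
Unset Printing Implicit Defensive.

Import Order.TTheory GRing.Theory Num.Theory.
Import numFieldNormedType.Exports.

Local Notation Re := (@complex.Re _).
Local Notation Im := (@complex.Im _).
Local Notation normc := (@ComplexField.Normc.normc _).

Local Open Scope classical_set_scope.
Local Open Scope ring_scope.

(* A function on (0, +oo) is represented by a total function on R whose values
   outside Rpos are irrelevant. *)
Definition Rpos (R : realType) : set R := `]0, +oo[.
Arguments Rpos : clear implicits.

Lemma measurable_Rpos (R : realType) : measurable (Rpos R).
Proof. exact: measurable_itv. Qed.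
#[global] Hint Resolve measurable_Rpos : core.

Section haar.
Variable R : realType.

(* the Haar measure r^-1 dr of (0, +oo), as a measure on R carried by Rpos *)
Definition haar (A : set (measurableTypeR R)) : \bar R :=
  (\int[@lebesgue_measure R]_(r in A `&` Rpos R) (r^-1)%:E)%E.

Let haar0 : haar set0 = 0%E.
Proof. by rewrite /haar set0I integral_set0. Qed.

Let haar_ge0 A : (0 <= haar A)%E.
Proof.
apply: integral_ge0 => r [_]; rewrite /Rpos/= in_itv/= andbT => r0.
by rewrite lee_fin invr_ge0 ltW.
Qed.

Let measurable_inv (D : set R) : measurable D -> D `<=` Rpos R ->
  measurable_fun D (fun r : R => (r^-1)%:E).
Proof.
move=> mD DR; apply/measurable_EFinP; apply: (measurable_funS (@measurable_Rpos R) DR).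
apply: open_continuous_measurable_fun; first exact: interval_open.
move=> r; rewrite inE /Rpos/= in_itv/= andbT => r0.
by apply: inv_continuous; rewrite gt_eqF.
Qed.

Let haar_sigma_additive : semi_sigma_additive haar.
Proof.
move=> F mF tF mUF; rewrite /haar setI_bigcupl.
have mFR k : measurable (F k `&` Rpos R).
  by apply: measurableI; [exact: mF|exact: measurable_Rpos].
rewrite ge0_integral_bigcup//=.
- by apply: is_cvg_ereal_nneg_natsum_cond => n _ _; exact: haar_ge0.
- apply: measurable_inv; first by apply: bigcup_measurable => k _; exact: mFR.
  by move=> r [k _ []].
- move=> r [k _ [_]]; rewrite /Rpos/= in_itv/= andbT => r0.
  by rewrite lee_fin invr_ge0 ltW.
- exact: trivIset_setIr.
Qed.

HB.instance Definition _ := isMeasure.Build _ _ _ haar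
  haar0 haar_ge0 haar_sigma_additive.

Let haar_sigma_finite : sigma_finite setT haar.
Proof.
pose F (n : nat) : set R := `]-oo, 0] `|` `[n.+1%:R^-1, n.+1%:R].
exists F.
  apply/esym; rewrite -subTset => r _.
  have [r0|r0] := leP r 0; first by exists 0%N => //; left; rewrite /= in_itv.
  have [n1 n1P] : exists n, r <= n.+1%:R.
    by exists (Num.truncn r); exact/ltW/truncnS_gt.
  have [n2 n2P] : exists n, r^-1 <= n.+1%:R.
    by exists (Num.truncn r^-1); exact/ltW/truncnS_gt.
  exists (maxn n1 n2) => //; right; rewrite /= in_itv/=; apply/andP; split.
    rewrite -[leRHS]invrK lef_pV2 ?posrE ?invr_gt0//.
    by rewrite (le_trans n2P)// ler_nat ltnS leq_maxr.
  by rewrite (le_trans n1P)// ler_nat ltnS leq_maxl.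
move=> n; have mF : measurable (F n) by apply: measurableU; exact: measurable_itv.
split => //; rewrite /haar.
pose I : set R := `[n.+1%:R^-1, n.+1%:R]%classic.
have FE : F n `&` Rpos R = I.
  rewrite /F /Rpos setIUl (_ : _ `&` _ = set0) ?set0U.
    apply/setIidPl => r; rewrite /= !in_itv/= => /andP[h _].
    by rewrite andbT (lt_le_trans _ h).
  rewrite -subset0 => r [] /=; rewrite !in_itv/= andbT => r0.
  by rewrite ltNge r0.
rewrite FE.
have sub : I `<=` Rpos R by rewrite -FE; exact: subIsetr.
have mI : measurable I by exact: measurable_itv.
apply: (@le_lt_trans _ _ (\int[@lebesgue_measure R]_(r in I) (n.+1%:R : R)%:E)%E).
  apply: ge0_le_integral => //.
  - by move=> r /sub; rewrite /Rpos/= in_itv/= andbT => r0; rewrite lee_fin invr_ge0 ltW.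
  - exact: measurable_inv.
  - move=> r rI; have := sub _ rI; rewrite /Rpos/= in_itv/= andbT => r0.
    move: rI; rewrite /I/= in_itv/= => /andP[h _].
    by rewrite lee_fin -[leRHS]invrK lef_pV2// posrE ?invr_gt0.
rewrite integral_cst//= lebesgue_measure_itv/=.
by case: ifP => _; rewrite ?mule0// -EFinB -EFinM ltry.
Qed.

HB.instance Definition _ := Measure_isSigmaFinite.Build _ _ _ haar
  haar_sigma_finite.

End haar.

Section complex_functions.
Variable R : realType.
Implicit Types (f g : R -> R[i]) (D : set R).

Definition cmeasurable_fun D f :=
  measurable_fun D (Re \o f) /\ measurable_fun D (Im \o f).

Definition cintegral (mu : {measure set (measurableTypeR R) -> \bar R}) D f : R[i] :=
  Complex (\int[mu]_(x in D) Re (f x)) (\int[mu]_(x in D) Im (f x)).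

(* e^(it) *)
Definition expi (t : R) : R[i] := Complex (cos t) (sin t).

Lemma measurable_normc D f : measurable D ->
  cmeasurable_fun D f -> measurable_fun D (normc \o f).
Proof.
move=> mD [mRe mIm].
rewrite (_ : normc \o f = fun x => Num.sqrt (Re (f x) ^+ 2 + Im (f x) ^+ 2)); last first.
  by apply/funext => x /=; case: (f x).
have msqrt : measurable_fun [set: R] (@Num.sqrt R).
  by apply: continuous_measurable_fun; exact: sqrt_continuous.
apply: (measurableT_comp msqrt).
by apply: measurable_funD; apply: measurable_funX.
Qed.

Lemma cmeasurable_funB D f g : measurable D ->
  cmeasurable_fun D f -> cmeasurable_fun D g -> cmeasurable_fun D (f \- g).
Proof.
move=> mD [fRe fIm] [gRe gIm]; split.
  rewrite (_ : _ \o _ = (Re \o f) \- (Re \o g)); first exact: measurable_funB.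
  by apply/funext => x /=; case: (f x) (g x) => [a b] [c d].
rewrite (_ : _ \o _ = (Im \o f) \- (Im \o g)); first exact: measurable_funB.
by apply/funext => x /=; case: (f x) (g x) => [a b] [c d].
Qed.

End complex_functions.

Section L2.
Variable R : realType.
Implicit Types f g h : R -> R[i].

(* (\int_0^oo |f r|^2 dr / r)^(1/2), in [0, +oo] *)
Definition L2norm f : \bar R :=
  'N[@haar R]_2%:E[EFin \o ((normc \o f) \_ (Rpos R))].

(* elements are functions rather than classes modulo a.e. equality: the
   topology below is that of the seminorm L2norm *)
Record L2 := MkL2 {
  L2_fun :> R -> R[i];
  L2_measurable : cmeasurable_fun (Rpos R) L2_fun;
  L2_finite : (L2norm L2_fun < +oo)%E
}.

HB.instance Definition _ := gen_eqMixin L2.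
HB.instance Definition _ := gen_choiceMixin L2.

Definition L2_ball (f : L2) (e : R) : set L2 :=
  [set g : L2 | (L2norm (f \- g)%R < e%:E)%E].

Lemma L2_ball_center (f : L2) (e : R) : 0 < e -> L2_ball f e f.
Proof.
move=> e0; rewrite /L2_ball/= /L2norm.
have -> : EFin \o ((normc \o (f \- f)%R) \_ (Rpos R)) = cst 0%E.
  apply/funext => x /=; rewrite patchE; case: ifPn => //= _.
  by rewrite subrr ComplexField.Normc.normc0.
by rewrite Lnorm0// eqe pnatr_eq0.
Qed.

Lemma L2_ball_sym (f g : L2) (e : R) : L2_ball f e g -> L2_ball g e f.
Proof.
suff E : L2norm (f \- g) = L2norm (g \- f) by rewrite /L2_ball/= E.
congr Lnorm; apply/funext => x /=; congr EFin.
rewrite !patchE; case: ifPn => //= _; rewrite -normcN; congr normc.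
by rewrite opprB.
Qed.

Lemma L2_ball_triangle (f g h : L2) (e1 e2 : R) :
  L2_ball f e1 g -> L2_ball g e2 h -> L2_ball f (e1 + e2) h.
Proof.
pose N (u v : L2) : R -> R := (normc \o (u \- v)) \_ (Rpos R).
have mN (u v : L2) : measurable_fun [set: R] (N u v).
  apply/(measurable_restrictT _ (@measurable_Rpos R)).
  apply: measurable_normc; first exact: measurable_Rpos.
  by apply: cmeasurable_funB; [exact: measurable_Rpos| |]; exact: L2_measurable.
have N_ge0 u v x : 0 <= N u v x.
  by rewrite /N patchE; case: ifPn => //= _; case: (_ - _) => a b; exact: sqrtr_ge0.
rewrite /L2_ball/= => fg gh; rewrite EFinD.
apply: le_lt_trans (lteD fg gh).
have le12 : (1 <= 2%:E :> \bar R)%E by rewrite lee1n.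
apply: le_trans (eminkowski (@haar R) (mN f g) (mN g h) le12).
rewrite /L2norm -/(N f h) unlock.
apply: gt0_ler_poweR; first by rewrite invr_ge0.
- by rewrite in_itv/= leey andbT integral_ge0// => x _; rewrite poweR_ge0.
- by rewrite in_itv/= leey andbT integral_ge0// => x _; rewrite poweR_ge0.
have mP (u : R -> R) : measurable_fun [set: R] u ->
    measurable_fun [set: R] (fun x => (`|(EFin \o u) x| `^ 2)%E).
  move=> mu; apply: (measurableT_comp (measurable_poweR _)) => //.
  by apply: measurableT_comp => //; exact/measurable_EFinP.
apply: ge0_le_integral => //.
- by move=> x _; rewrite poweR_ge0.
- exact: mP.
- by apply: mP; exact: measurable_funD.
- move=> x _; apply: gt0_ler_poweR => //.
  + by rewrite in_itv/= leey andbT lee_fin normr_ge0.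
  + by rewrite in_itv/= leey andbT lee_fin normr_ge0.
  rewrite /= lee_fin !ger0_norm ?addr_ge0//.
  rewrite /N !patchE; case: ifPn => /= _; rewrite ?addr0//.
  rewrite (_ : f x - h x = (f x - g x) + (g x - h x)) ?le_normcD//.
  by rewrite addrA subrK.
Qed.

HB.instance Definition _ := hasNbhs.Build L2 (nbhs_ (entourage_ L2_ball)).
HB.instance Definition _ := Nbhs_isPseudoMetric.Build R L2
  erefl L2_ball_center L2_ball_sym L2_ball_triangle erefl.

End L2.

Definition real_schwartz (R : realType) (g : R -> R) :=
  (forall k (x : R), derivable (derive1n k g) x 1) /\
  (forall m k, exists C : R, forall x : R, `|x ^+ m * derive1n k g x| <= C).

(* equivalent to rapid decay of the complex derivatives, since these are
   computed componentwise *)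
Definition schwartz (R : realType) (g : R -> R[i]) :=
  real_schwartz (Re \o g) /\ real_schwartz (Im \o g).

(* f belongs to S((0, +oo)) *)
Definition schwartz_Rpos (R : realType) (f : R -> R[i]) := schwartz (f \o expR).

(* the integrand is meaningless at u = 0, a Lebesgue-null point *)
Definition affine_Wigner (R : realType) (f : R -> R[i]) (w r : R) : R[i] :=
  cintegral lebesgue_measure setT (fun u =>
    f (r * u * expR u / (expR u - 1)) *
    conjc (f (r * u / (expR u - 1))) * expi (- (2 * pi * w * u))).

Definition tail_region (R : realType) (xi : R) : set (R * R) :=
  ([set: R] `*` Rpos R) `\` (`[- xi, xi] `*` `[xi^-1, xi]).

Definition tail_mass (R : realType) (f : R -> R[i]) (xi : R) : \bar R :=
  (\int[@lebesgue_measure R \x @haar R]_(p in tail_region xi)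
    (normc (affine_Wigner f p.1 p.2))%:E)%E.

(* a supremum in [0, +oo]: it is 0, not -oo, when K is empty *)
Definition sup_tail_mass (R : realType) (K : set (L2 R)) (xi : R) : \bar R :=
  maxe 0%E (ereal_sup [set tail_mass f xi | f in K]).

(* Main.v *)
From HB Require Import structures.
Require Import Defs.
From mathcomp Require Import all_boot all_order all_algebra.
From mathcomp Require Import all_classical all_reals all_analysis.
From mathcomp Require Import measurable_realfun.
From mathcomp Require Import complex ring lra.
Set Implicit Arguments.
Unset Strict Implicit.
Unset Printing Implicit Defensive.
Import Order.TTheory GRing.Theory Num.Theory.
Import numFieldNormedType.Exports.
Local Open Scope classical_set_scope.
Local Open Scope ring_scope.

Local Notation Re := (@complex.Re _).
Local Notation Im := (@complex.Im _).
Local Notation normc := (@ComplexField.Normc.normc _).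

(** Write g(x) = f(e^x), so that the Haar measure becomes Lebesgue measure, and
    l(u) = log (u / (e^u - 1)).  Then W f(w, e^x) is the Fourier transform in u
    of g(x + l u + u) times the conjugate of g(x + l u).  Smallness of the
    Wigner distribution outside a box gives smallness of g in space and in
    frequency, because two marginals of W are explicit.

    - Frequency.  The map (x, u) -> (x + l u + u, x + l u) preserves the area of
      the plane ([shear_preserving]), so integrating W in x gives exactly the
      square modulus of the Fourier transform of g at w
      ([Rintegral_wigner_re]).
    - Space.  As l vanishes at 0, the function of u above takes the value
      |g(x)|^2 at u = 0.  Fourier inversion there bounds |g(x)|^2 by the
      integral of |W(w, e^x)| in w, for almost every x
      ([ae_le_integral_wigner_re]).

    Hence a small tail mass at level xi bounds both the energy of g outside
    |x| <= log xi and the energy of its transform outside |w| <= xi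
    ([mass_tail_le], [power_spectrum_tail_le]).

    Inversion, Bessel's inequality and Plancherel's inequality come from a
    single identity ([Rintegral_abel_re_fourier]): integrating a Fourier
    transform against the Abel weight e^(-2 pi s |w|) averages the function
    against the Cauchy density of width s.  Letting s tend to 0 gives a lower
    bound at a point of continuity ([ge0_le_integral_re_fourier]) and, for a
    nonnegative transform, an upper bound ([integral_re_fourier_le]).  The last
    two inequalities are these bounds for the autocorrelation of g, whose
    transform is the power spectrum.

    The rest is a Riesz-Kolmogorov argument.  For a difference g of two members
    of K, Plancherel splits the energy into high frequencies, which are small,
    and low ones, where Bessel allows g to be replaced by its truncation to
    |x| <= log xi ([concentrated_close]).  The transforms of the truncations are
    uniformly bounded and equi-Lipschitz, so that finitely many codes determine
    them up to a small error on [-xi, xi] ([equilipschitz_code]).  So K is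
    covered by finitely many balls of any given radius
    ([concentrated_cover]), and since L2 is complete ([L2_complete], proved
    by the Riesz-Fischer argument) its closure is compact
    ([totally_bounded_precompact]). *)

(** * Measure-preserving maps and Lebesgue measure *)

Section measure_preserving.
Context d1 d2 (X : measurableType d1) (Y : measurableType d2) (R : realType).
Variables (m1 : {measure set X -> \bar R}) (m2 : {measure set Y -> \bar R}).

Definition measure_preserving (phi : X -> Y) :=
  measurable_fun setT phi /\
  forall A, measurable A -> m1 (phi @^-1` A) = m2 A.

Variable phi : X -> Y.
Hypothesis phiP : measure_preserving phi.

Lemma ge0_integral_preserving (f : Y -> \bar R) :
  measurable_fun setT f -> (forall y, 0 <= f y)%E ->
  (\int[m1]_x f (phi x) = \int[m2]_y f y)%E.
Proof.
case: phiP => mphi pres mf f0.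
rewrite -[LHS]/(\int[m1]_(x in phi @^-1` setT) (f \o phi) x)%E.
rewrite -ge0_integral_pushforward//.
by apply: eq_measure_integral => A mA _; exact: pres.
Qed.

Lemma integrable_preserving (f : Y -> R) :
  m2.-integrable setT (EFin \o f) ->
  m1.-integrable setT (EFin \o (f \o phi)).
Proof.
case: (phiP) => mphi _ /integrableP[mf fi].
apply/integrableP; split; first exact: (measurableT_comp mf).
rewrite (@ge0_integral_preserving (fun y => `|(f y)%:E|)%E)//.
exact: measurableT_comp.
Qed.

Lemma Rintegral_preserving (f : Y -> R) : measurable_fun setT f ->
  \int[m1]_x f (phi x) = \int[m2]_y f y.
Proof.
move=> /measurable_EFinP mf; case: (phiP) => mphi _.
rewrite /Rintegral; congr fine; rewrite integralE [RHS]integralE.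
congr (_ - _)%E.
  rewrite -(ge0_integral_preserving (measurable_funepos mf))//.
  by apply: eq_integral => x _; rewrite !unlock.
rewrite -(ge0_integral_preserving (measurable_funeneg mf))//.
by apply: eq_integral => x _; rewrite !unlock.
Qed.

End measure_preserving.

Section lebesgue_invariance.
Variable R : realType.
Notation mu := (@lebesgue_measure R).

Lemma lebesgue_measure_translation (b : R) :
  measure_preserving mu mu (fun x : R => x + b).
Proof.
have mphi : measurable_fun setT (fun x : R => x + b) by exact: measurable_funD.
split => // A mA.
pose phi : measurableTypeR R -> measurableTypeR R := fun x : R => x + b.
apply/esym; apply: (@lebesgue_measure_unique _ (pushforward mu phi)) => // _ [[c d] _ <-] /=.
rewrite /pushforward (_ : _ @^-1` _ = `]c - b, d - b]%classic).
  rewrite !lebesgue_measure_itv/= !lte_fin ltrD2r.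
  by case: ifP => // _; rewrite -!EFinB; congr EFin; ring.
by apply/seteqP; split => x /=; rewrite !in_itv/= ltrBlDr lerBrDr.
Qed.

Lemma lebesgue_measure_opp : measure_preserving mu mu (fun x : R => - x).
Proof.
have mphi : measurable_fun setT (fun x : R => - x) by exact: measurable_funN.
split => // A mA.
pose phi : measurableTypeR R -> measurableTypeR R := fun x : R => - x.
apply/esym; apply: (@lebesgue_measure_unique _ (pushforward mu phi)) => // _ [[c d] _ <-] /=.
rewrite /pushforward (_ : _ @^-1` _ = `[- d, - c[%classic).
  rewrite !lebesgue_measure_itv/= !lte_fin ltrN2.
  by case: ifP => // _; rewrite -!EFinB; congr EFin; ring.
by apply/seteqP; split => x /=; rewrite !in_itv/= ltrNr lerNl andbC.
Qed.

Lemma ge0_integral_scale (a : R) (f : R -> \bar R) : 0 < a ->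
  measurable_fun setT f -> (forall y, 0 <= f y)%E ->
  (\int[mu]_x f x = a%:E * \int[mu]_x f (a * x)%R)%E.
Proof.
move=> a0 mf f0.
have mphi : measurable_fun setT (fun x : R => a * x) by exact: measurable_funM.
pose phi : measurableTypeR R -> measurableTypeR R := fun x : R => a * x.
pose k : {nonneg R} := NngNum (ltW a0).
rewrite (@eq_measure_integral _ _ _ _ (mscale k (pushforward mu phi))); last first.
  move=> A mA _; apply: lebesgue_measure_unique => // _ [[c d] _ <-] /=.
  rewrite /mscale/= /pushforward (_ : _ @^-1` _ = `]c / a, d / a]%classic).
    rewrite !lebesgue_measure_itv/= !lte_fin ltr_pM2r ?invr_gt0//.
    case: ifP => // _; rewrite ?mule0// -!EFinB -EFinM; congr EFin.
    by field; rewrite gt_eqF.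
  by apply/seteqP; split => x /=; rewrite !in_itv/= ltr_pdivrMr// ler_pdivlMr// mulrC.
rewrite (@ge0_integral_mscale _ _ _ _ _ measurableT k)//; congr (_ * _)%E.
by rewrite ge0_integral_pushforward.
Qed.

End lebesgue_invariance.

Section shear.
Variable R : realType.
Notation mu := (@lebesgue_measure R).
Variable l : R -> R.
Hypothesis ml : measurable_fun setT l.

(** In the coordinates s = x + l u + u and t = x + l u one has s - t = u, so that
    a phase in u splits into a phase in s and a phase in t. *)
Definition shear (z : R * R) : R * R := (z.1 + l z.2 + z.2, z.1 + l z.2).

Lemma measurable_shear : measurable_fun setT shear.
Proof.
apply: measurable_fun_pair => /=.
  apply: measurable_funD => //; apply: measurable_funD => //.
  by apply: (measurableT_comp ml).
by apply: measurable_funD => //; apply: (measurableT_comp ml).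
Qed.

(** For fixed u the map translates x by l u; after that l has disappeared, and
    (y, u) -> (y + u, y) is a translation of u for each fixed y. *)
Lemma shear_preserving : measure_preserving (mu \x mu)%E (mu \x mu)%E shear.
Proof.
split; first exact: measurable_shear.
move=> A mA.
have mS : measurable (shear @^-1` A).
  by rewrite -[X in measurable X]setTI; exact: measurable_shear.
rewrite -[LHS]mul1e -integral_cst//= -[RHS]mul1e -integral_cst//=.
rewrite integral_mkcond [RHS]integral_mkcond.
pose H : R * R -> \bar R := ((cst 1%E) \_ A)%E.
have mH : measurable_fun setT H by apply/(measurable_restrictT _ mA).
have H0 z : (0 <= H z)%E by apply: erestrict_ge0.
rewrite (_ : _ \_ _ = H \o shear); last by apply/funext => z; rewrite /H /= !patchE.
have mHs : measurable_fun setT (H \o shear) by exact: (measurableT_comp mH measurable_shear).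
rewrite [LHS](fubini_tonelli2 (m1 := mu) (m2 := mu) (H \o shear) mHs (fun z => H0 _)) /fubini_G /=.
have mH1 : measurable_fun setT (fun z : R * R => H (z.1 + z.2, z.1)).
  apply: (@measurableT_comp _ _ _ _ _ _ H _ (fun z : R * R => (z.1 + z.2, z.1))) => //.
  by apply: measurable_fun_pair => //; exact: measurable_funD.
have mHu (u : R) : measurable_fun setT (fun y : R => H (y + u, y)).
  exact: (measurableT_comp mH1 (measurable_fun_pair _ _)).
have mHy (y : R) : measurable_fun setT (fun s : R => H (s, y)).
  exact: (measurableT_comp mH (measurable_fun_pair _ _)).
transitivity (\int[mu]_u \int[mu]_y H ((y + u)%R, y))%E.
  apply: eq_integral => u _; rewrite /shear/=.
  by rewrite -(ge0_integral_preserving (lebesgue_measure_translation (l u)) (mHu u)).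
rewrite -(fubini_tonelli (m1 := mu) (m2 := mu) (fun z : R * R => H (z.1 + z.2, z.1)) mH1 (fun z => H0 _))/=.
rewrite -/H [RHS](fubini_tonelli2 (m1 := mu) (m2 := mu) H mH H0); apply: eq_integral => y _.
rewrite /fubini_G/= -(ge0_integral_preserving (lebesgue_measure_translation y) (mHy y))//.
by apply: eq_integral => u _; rewrite addrC.
Qed.

End shear.

(** * Real-valued integrals over product measures *)

Section Rintegral_product.
Context d1 d2 (X : measurableType d1) (Y : measurableType d2) (R : realType).
Variables (m1 : {sigma_finite_measure set X -> \bar R})
          (m2 : {sigma_finite_measure set Y -> \bar R}).
Notation m12 := (m1 \x m2)%E.

Lemma measurable_Rintegral_section (H : X * Y -> R) : measurable_fun setT H ->
  measurable_fun setT (fun x => \int[m2]_y H (x, y)).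
Proof.
move=> /measurable_EFinP mH; apply: measurableT_comp => //.
rewrite (_ : (fun x => _) = (fun x => fubini_F m2 (EFin \o H)^\+%E x - fubini_F m2 (EFin \o H)^\-%E x)%E).
  by apply: emeasurable_funB; apply: measurable_fun_fubini_tonelli_F => //;
    [exact: measurable_funepos|exact: measurable_funeneg].
apply/funext => x; rewrite integralE /fubini_F; congr (_ - _)%E.
  by apply: eq_integral => y _; rewrite !unlock.
by apply: eq_integral => y _; rewrite !unlock.
Qed.

Variable H : X * Y -> R.
Hypothesis iH : m12.-integrable setT (EFin \o H).

Let mH : measurable_fun setT H.
Proof. by apply/measurable_EFinP; case/integrableP: iH. Qed.

Lemma measurable_Rintegral_section2 :
  measurable_fun setT (fun y => \int[m1]_x H (x, y)).
Proof.
apply: measurableT_comp => //.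
rewrite (_ : (fun x => _) = (fun y => fubini_G m1 (EFin \o H)^\+%E y - fubini_G m1 (EFin \o H)^\-%E y)%E).
  apply: emeasurable_funB; apply: measurable_fun_fubini_tonelli_G => //.
    by apply: measurable_funepos; exact/measurable_EFinP.
  by apply: measurable_funeneg; exact/measurable_EFinP.
apply/funext => x; rewrite integralE /fubini_G; congr (_ - _)%E.
  by apply: eq_integral => y _; rewrite !unlock.
by apply: eq_integral => y _; rewrite !unlock.
Qed.

Let ae12 : ae_eq m1 setT (fun x => (\int[m2]_y H (x, y))%:E) (fubini_F m2 (EFin \o H)).
Proof.
move: (ae_integrable1 iH); apply: filterS => x ix _.
by rewrite /Rintegral fineK//; exact: integrable_fin_num.
Qed.

Let ae21 : ae_eq m2 setT (fun y => (\int[m1]_x H (x, y))%:E) (fubini_G m1 (EFin \o H)).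
Proof.
move: (ae_integrable2 iH); apply: filterS => x ix _.
by rewrite /Rintegral fineK//; exact: integrable_fin_num.
Qed.

Lemma integrable_Rintegral_section :
  m1.-integrable setT (fun x => (\int[m2]_y H (x, y))%:E).
Proof.
have /integrableP[mF iF] := integrable_fubini_F iH.
have mG : measurable_fun setT (fun x => (\int[m2]_y H (x, y))%:E).
  by apply/measurable_EFinP; exact: measurable_Rintegral_section.
apply/integrableP; split => //.
rewrite (ge0_ae_eq_integral (g := fun x => `|fubini_F m2 (EFin \o H) x|%E))//.
- exact: measurableT_comp.
- exact: measurableT_comp.
- by move: ae12; apply: filterS => x /= h _; rewrite -h.
Qed.

(** The inner integral is finite for almost every point only; elsewhere the
    real-valued integral is 0, which changes a null set. *)
Lemma integrable_Rintegral_section2 :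
  m2.-integrable setT (fun y => (\int[m1]_x H (x, y))%:E).
Proof.
have mG : measurable_fun setT (fun y => (\int[m1]_x H (x, y))%:E).
  by apply/measurable_EFinP; exact: measurable_Rintegral_section2.
have mHE : measurable_fun setT (EFin \o H) by exact/measurable_EFinP.
apply/integrableP; split => //.
apply: le_lt_trans ((integrable21ltyP _ _ mHE).1 iH).
apply: ae_ge0_le_integral => //.
- exact: measurableT_comp.
- by move=> y _; exact: integral_ge0.
- apply: (measurable_fun_fubini_tonelli_G (fun z => `|(H z)%:E|%E)) => //.
  exact: measurableT_comp.
- move: ae21; apply: filterS => y /= yE _; rewrite -[leLHS]/(`|(\int[m1]_x H (x, y))%:E|%E) yE//; apply: le_abse_integral => //.
  exact: (measurableT_comp mHE).
Qed.

Lemma Rintegral_prod1 :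
  \int[m12]_z H z = \int[m1]_x \int[m2]_y H (x, y).
Proof.
rewrite {1}/Rintegral -(integral12_prod_meas1 iH) {1}/Rintegral; congr fine.
apply/esym; apply: ae_eq_integral => //.
  by apply/measurable_EFinP; exact: measurable_Rintegral_section.
by case/integrableP : (integrable_fubini_F iH).
Qed.

Lemma Rintegral_prod2 :
  \int[m12]_z H z = \int[m2]_y \int[m1]_x H (x, y).
Proof.
rewrite {1}/Rintegral -(integral21_prod_meas1 iH) {1}/Rintegral; congr fine.
apply/esym; apply: ae_eq_integral => //.
  by apply/measurable_EFinP; exact: measurable_Rintegral_section2.
exact: (measurable_fubini_G iH).
Qed.

End Rintegral_product.

Section tensor.
Context d1 d2 (X : measurableType d1) (Y : measurableType d2) (R : realType).
Variables (m1 : {sigma_finite_measure set X -> \bar R})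
          (m2 : {sigma_finite_measure set Y -> \bar R}).
Notation m12 := (m1 \x m2)%E.
Variables (f : X -> R) (g : Y -> R).
Hypotheses (fi : m1.-integrable setT (EFin \o f))
           (gi : m2.-integrable setT (EFin \o g)).

Lemma integrable_tensor : m12.-integrable setT (fun z => (f z.1 * g z.2)%:E).
Proof.
have /integrableP[/measurable_EFinP mf fi'] := fi.
have /integrableP[/measurable_EFinP mg gi'] := gi.
have mfg : measurable_fun setT (fun z : X * Y => (f z.1 * g z.2)%:E).
  by apply/measurable_EFinP; apply: measurable_funM;
    [exact: measurableT_comp mf _|exact: measurableT_comp mg _].
apply/(integrable12ltyP _ _ mfg) => /=.
under eq_integral => x _.
  under eq_integral do rewrite normrM EFinM.
  rewrite ge0_integralZl//=; last first.
    by apply/measurable_EFinP; exact: measurableT_comp.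
  over.
rewrite ge0_integralZr//=.
- by rewrite lte_mul_pinfty// ?integral_ge0// ge0_fin_numE// integral_ge0.
- by apply/measurable_EFinP; exact: measurableT_comp.
- exact: integral_ge0.
Qed.

Lemma Rintegral_tensor :
  \int[m12]_z (f z.1 * g z.2) = \int[m1]_x f x * \int[m2]_y g y.
Proof.
rewrite Rintegral_prod1; last exact: integrable_tensor.
rewrite -RintegralZr//; apply: eq_Rintegral => x _ /=.
by rewrite RintegralZl.
Qed.

End tensor.

(** * The Abel weight and the Cauchy density *)

Section abel.
Variable R : realType.
Notation mu := (@lebesgue_measure R).

Definition abel (s w : R) : R := expR (- (2 * pi * s * `|w|)).

Lemma abel_ge0 s w : 0 <= abel s w. Proof. exact: expR_ge0. Qed.

Lemma abel_le1 s w : 0 < s -> abel s w <= 1.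
Proof.
move=> s0; rewrite /abel -[leRHS]expR0 ler_expR oppr_le0 !mulr_ge0//.
  exact: pi_ge0.
exact: ltW.
Qed.

Lemma continuous_abel s : continuous (abel s).
Proof.
move=> x; apply: (continuous_comp (f := fun w : R => - (2 * pi * s * `|w|))).
  apply: cvgN; apply: cvgM; first exact: cvg_cst.
  exact: norm_continuous.
exact: continuous_expR.
Qed.

Lemma measurable_abel s : measurable_fun setT (abel s).
Proof. by apply: continuous_measurable_fun; exact: continuous_abel. Qed.

Definition cauchy_density (v : R) : R := (pi * (1 + v ^+ 2))^-1.

Lemma cauchy_density_ge0 v : 0 <= cauchy_density v.
Proof. by rewrite invr_ge0 mulr_ge0 ?pi_ge0// addr_ge0// sqr_ge0. Qed.

Lemma continuous_cauchy_density : continuous cauchy_density.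
Proof.
rewrite (_ : cauchy_density = fun v => pi^-1 * (oneDsqr v)^-1); last first.
  by apply/funext => v; rewrite /cauchy_density invfM.
move=> x; apply: cvgM; first exact: cvg_cst.
exact: continuous_oneDsqrV.
Qed.

Lemma integral_cauchy_density : (\int[mu]_v (cauchy_density v)%:E = 1)%E.
Proof.
rewrite ge0_symfun_integralT//; [|exact: cauchy_density_ge0|exact: continuous_cauchy_density|]; last first.
  by move=> v; rewrite /cauchy_density /= sqrrN.
rewrite -set_itvcy.
under eq_integral => v _ do rewrite /cauchy_density invfM EFinM.
rewrite ge0_integralZl//=.
- have := integral0y_oneDsqr R; rewrite /oneDsqr => ->.
  rewrite -!EFinM; congr EFin; move: (pi_gt0 R); move: pi => p p0.
  by field; rewrite gt_eqF.
- apply/measurable_EFinP; apply: measurable_funTS.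
  apply: continuous_measurable_fun; exact: continuous_oneDsqrV.
- by move=> x _; rewrite lee_fin invr_ge0 addr_ge0// sqr_ge0.
- by rewrite lee_fin invr_ge0 pi_ge0.
Qed.

Lemma integrable_cauchy_density : mu.-integrable setT (EFin \o cauchy_density).
Proof.
apply/integrableP; split.
  by apply/measurable_EFinP; apply: continuous_measurable_fun; exact: continuous_cauchy_density.
under eq_integral => x _ do rewrite /= ger0_norm ?cauchy_density_ge0//.
by rewrite integral_cauchy_density ltry.
Qed.

(** Adding 1 to the cosine makes the integrand nonnegative, so that the
    fundamental theorem of calculus applies directly on the half-line. *)
Lemma integral_exp_cos (e c : R) : 0 < e ->
  (\int[mu]_(x in `[0%R, +oo[) (expR (- (e * x)) * (1 + cos (c * x)))%:E =
   (e^-1 + e / (e ^+ 2 + c ^+ 2))%:E)%E.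
Proof.
move=> e0.
have ec0 : e ^+ 2 + c ^+ 2 != 0 by rewrite gt_eqF// ltr_pwDl ?sqr_ge0// exprn_gt0.
pose F (x : R) := expR (- (e * x)) *
  ((c * sin (c * x) - e * cos (c * x)) / (e ^+ 2 + c ^+ 2) - e^-1).
have dF (x : R) : is_derive x 1 F (expR (- (e * x)) * (1 + cos (c * x))).
  rewrite /F; apply: is_derive_eq.
  by rewrite /GRing.scale/=; field; rewrite ec0 gt_eqF.
rewrite (@ge0_continuous_FTC2y _ _ F 0 0).
- by rewrite /F !mulr0 sin0 cos0 oppr0 expR0 -EFinB; congr EFin; field; rewrite ec0 gt_eqF.
- move=> x _; apply: mulr_ge0; first exact: expR_ge0.
  by have := cos_geN1 (c * x); lra.
- apply: continuous_subspaceT => x.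
  apply: cvgM.
    apply: (continuous_comp (f := fun x : R => - (e * x))); last exact: continuous_expR.
    by apply: cvgN; apply: cvgM; [exact: cvg_cst|exact: cvg_id].
  apply: cvgD; first exact: cvg_cst.
  apply: (continuous_comp (f := fun x : R => c * x)); last exact: continuous_cos.
  by apply: cvgM; [exact: cvg_cst|exact: cvg_id].
- pose B := ((`|c| + e) / (e ^+ 2 + c ^+ 2) + e^-1).
  apply/cvgrPdist_le => d d0.
  have B0 : 0 < B.
    rewrite ltr_wpDl ?invr_gt0// divr_ge0 ?addr_ge0 ?sqr_ge0//; exact: ltW.
  near=> x; rewrite sub0r normrN /F normrM (ger0_norm (expR_ge0 _)).
  have FB : `|(c * sin (c * x) - e * cos (c * x)) / (e ^+ 2 + c ^+ 2) - e^-1| <= B.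
    apply: (le_trans (ler_normB _ _)); apply: lerD; last first.
      by rewrite ger0_norm// invr_ge0 ltW.
    rewrite normrM [X in _ * X]ger0_norm ?invr_ge0 ?addr_ge0 ?sqr_ge0//.
    apply: ler_wpM2r; first by rewrite invr_ge0 addr_ge0 ?sqr_ge0.
    apply: (le_trans (ler_normB _ _)); rewrite !normrM; apply: lerD.
      by rewrite -[leRHS]mulr1; apply: ler_wpM2l => //; exact: sin_max.
    rewrite (ger0_norm (ltW e0)) -[leRHS]mulr1.
    by apply: ler_wpM2l; [exact: ltW|exact: cos_max].
  apply: (le_trans (ler_wpM2l (expR_ge0 _) FB)).
  rewrite -ler_pdivlMr// expRN -[leRHS]invrK lef_pV2 ?posrE ?expR_gt0 ?invr_gt0 ?divr_gt0//.
  apply: (le_trans _ (expR_ge1Dx _)).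
  rewrite -lerBlDl.
  have : e^-1 * ((d / B)^-1 - 1) <= x.
    by near: x; apply: nbhs_pinfty_ge; rewrite num_real.
  by rewrite ler_pdivrMl.
- by move=> x _; exact: ex_derive.
- apply: cvg_at_right_filter; apply: differentiable_continuous.
  by apply/derivable1_diffP; exact: ex_derive.
- by move=> x _; rewrite derive1E; exact: derive_val.
Unshelve. all: by end_near. Qed.

Lemma integral_abel_1cos (s u : R) : 0 < s ->
  (\int[mu]_w (abel s w * (1 + cos (2 * pi * w * u)))%:E =
   ((pi * s)^-1 + s^-1 * cauchy_density (u / s))%:E)%E.
Proof.
move=> s0.
have p0 := @pi_gt0 R.
rewrite ge0_symfun_integralT.
- rewrite -set_itvcy.
  under eq_integral => w.
    rewrite inE/= in_itv/= andbT => w0.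
    rewrite /abel ger0_norm// (_ : 2 * pi * w * u = 2 * pi * u * w); last by ring.
    over.
  rewrite integral_exp_cos; last by rewrite !mulr_gt0.
  rewrite -EFinM; congr EFin; rewrite /cauchy_density; move: p0; move: pi => p p0.
  have su : 0 < s ^+ 2 + u ^+ 2 by rewrite ltr_pwDl ?sqr_ge0// exprn_gt0.
  field; rewrite !gt_eqF//= (_ : _ + _ = (2 * p) ^+ 2 * (s ^+ 2 + u ^+ 2)); last by ring.
  by rewrite mulr_gt0// exprn_gt0// mulr_gt0.
- move=> x; apply: mulr_ge0; first exact: abel_ge0.
  by have := cos_geN1 (2 * pi * x * u); lra.
- move=> x; apply: cvgM; first exact: continuous_abel.
  apply: cvgD; first exact: cvg_cst.
  apply: (continuous_comp (f := fun w : R => 2 * pi * w * u)); last exact: continuous_cos.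
  by apply: cvgM; [apply: cvgM; [exact: cvg_cst|exact: cvg_id]|exact: cvg_cst].
- by move=> w /=; rewrite /abel normrN mulrN mulNr cosN.
Qed.

Lemma integrable_abel (s : R) : 0 < s -> mu.-integrable setT (EFin \o abel s).
Proof.
move=> s0; have := integral_abel_1cos 0 s0.
under eq_integral do rewrite mulr0 cos0; move=> E.
have ig : mu.-integrable setT (EFin \o (fun w => abel s w * (1 + 1))).
  apply/integrableP; split.
    by apply/measurable_EFinP/measurable_funM => //; exact: measurable_abel.
  under eq_integral => w _.
    rewrite /= ger0_norm ?mulr_ge0 ?abel_ge0 ?addr_ge0//.
    over.
  by rewrite E ltry.
apply: le_integrable ig => //.
- by apply/measurable_EFinP; exact: measurable_abel.
- move=> w _ /=; rewrite lee_fin ger0_norm ?abel_ge0// ger0_norm.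
    by rewrite ler_peMr ?abel_ge0// lerDl.
  by rewrite mulr_ge0 ?abel_ge0// addr_ge0.
Qed.

End abel.

Section abel_fourier.
Variable R : realType.
Notation mu := (@lebesgue_measure R).

Lemma continuous_phase (w : R) : continuous (fun u : R => 2 * pi * w * u).
Proof. by move=> u; apply: cvgM; [exact: cvg_cst|exact: cvg_id]. Qed.

Lemma measurable_cos_phase (w : R) : measurable_fun setT (fun u : R => cos (2 * pi * w * u)).
Proof.
apply: continuous_measurable_fun => u.
by apply: (continuous_comp (@continuous_phase w u)); exact: continuous_cos.
Qed.

Lemma measurable_sin_phase (w : R) : measurable_fun setT (fun u : R => sin (2 * pi * w * u)).
Proof.
apply: continuous_measurable_fun => u.
by apply: (continuous_comp (@continuous_phase w u)); exact: continuous_sin.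
Qed.

Lemma integrable_scaler (c : R) (f : R -> R) : mu.-integrable setT (EFin \o f) ->
  mu.-integrable setT (fun x => (c * f x)%:E).
Proof. by move=> fi; exact: (integrableZl measurableT c fi). Qed.

Lemma integrable_addr (f g : R -> R) : mu.-integrable setT (EFin \o f) ->
  mu.-integrable setT (EFin \o g) -> mu.-integrable setT (fun x => (f x + g x)%:E).
Proof. by move=> fi gi; exact: (integrableD measurableT fi gi). Qed.

Lemma integrable_comp_scale (a : R) (f : R -> R) : 0 < a ->
  mu.-integrable setT (EFin \o f) -> mu.-integrable setT (fun x => (f (a * x))%:E).
Proof.
move=> a0 /integrableP[mf fi].
have mfa : measurable_fun setT (fun x : R => (f (a * x))%:E).
  by apply: (measurableT_comp mf); exact: measurable_funM.
apply/integrableP; split => //.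
have mnf : measurable_fun setT (fun x => `|(EFin \o f) x|%E) by exact: measurableT_comp.
move: fi; rewrite (ge0_integral_scale a0 mnf)//.
have : (0 <= \int[mu]_x `|(EFin \o f) (a * x)%R|)%E by exact: integral_ge0.
case: (\int[mu]_x _)%E => [r _ _|_|//]; first exact: ltry.
by rewrite mulry gtr0_sg// mul1e.
Qed.

Lemma integrable_mul_bounded (c : R) (f h : R -> R) : mu.-integrable setT (EFin \o f) ->
  measurable_fun setT h -> (forall x, `|h x| <= c) ->
  mu.-integrable setT (fun x => (f x * h x)%:E).
Proof.
move=> fi mh hc; have mf : measurable_fun setT f.
  by apply/measurable_EFinP; case/integrableP : fi.
have c0 : 0 <= c by apply: le_trans (hc 0).
have ic : mu.-integrable setT (EFin \o (fun x => c * `|f x|)).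
  by apply: integrable_scaler; exact: (integrable_norm fi).
apply: le_integrable ic => //.
  by apply/measurable_EFinP; exact: measurable_funM.
move=> x _ /=; rewrite lee_fin (ger0_norm (mulr_ge0 c0 _))// normrM mulrC.
exact: ler_wpM2r.
Qed.

Lemma Rintegral_scale (a : R) (f : R -> R) : 0 < a ->
  mu.-integrable setT (EFin \o f) ->
  \int[mu]_x f x = a * \int[mu]_x f (a * x).
Proof.
move=> a0 fi; have /integrableP[mf _] := fi.
have S (g : R -> \bar R) : measurable_fun setT g -> (forall y, 0 <= g y)%E ->
    (\int[mu]_x g (a * x)%R = a^-1%:E * \int[mu]_x g x)%E.
  move=> mg g0; rewrite (ge0_integral_scale a0 mg g0) muleA -EFinM mulVf ?gt_eqF//.
  by rewrite mul1e.
rewrite /Rintegral integralE [in RHS]integralE.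
have -> : (\int[mu]_x (fun x => (f (a * x)%R)%:E)^\+ x = a^-1%:E * \int[mu]_x (EFin \o f)^\+ x)%E.
  rewrite -S//; last exact: measurable_funepos.
  by apply: eq_integral => x _; rewrite !unlock.
have -> : (\int[mu]_x (fun x => (f (a * x)%R)%:E)^\- x = a^-1%:E * \int[mu]_x (EFin \o f)^\- x)%E.
  rewrite -S//; last exact: measurable_funeneg.
  by apply: eq_integral => x _; rewrite !unlock.
have := integrable_pos_fin_num measurableT fi.
have := integrable_neg_fin_num measurableT fi.
case: (\int[mu]_x (EFin \o f)^\- x)%E => // N _.
case: (\int[mu]_x (EFin \o f)^\+ x)%E => // P _.
by rewrite /=; field; rewrite gt_eqF.
Qed.

Lemma Rintegral_odd (f : R -> R) : mu.-integrable setT (EFin \o f) ->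
  (forall x, f (- x) = - f x) -> \int[mu]_x f x = 0.
Proof.
move=> fi fo; have mf : measurable_fun setT f.
  by apply/measurable_EFinP; case/integrableP : fi.
have := Rintegral_preserving (lebesgue_measure_opp R) mf.
under eq_Rintegral do rewrite fo -mulN1r.
by rewrite RintegralZl// mulN1r => h; lra.
Qed.

Variable s : R.
Hypothesis s0 : 0 < s.

Lemma integrable_abel_cos (u : R) :
  mu.-integrable setT (fun w => (abel s w * cos (2 * pi * w * u))%:E).
Proof.
apply: (integrable_mul_bounded (c := 1) (integrable_abel s0)).
- under eq_fun do rewrite mulrAC; exact: measurable_cos_phase.
- by move=> x; exact: cos_max.
Qed.

Lemma integrable_abel_sin (u : R) :
  mu.-integrable setT (fun w => (abel s w * sin (2 * pi * w * u))%:E).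
Proof.
apply: (integrable_mul_bounded (c := 1) (integrable_abel s0)).
- under eq_fun do rewrite mulrAC; exact: measurable_sin_phase.
- by move=> x; exact: sin_max.
Qed.

Lemma Rintegral_abel_sin (u : R) : \int[mu]_w (abel s w * sin (2 * pi * w * u)) = 0.
Proof.
apply: Rintegral_odd; first exact: integrable_abel_sin.
by move=> w; rewrite /abel normrN mulrN mulNr sinN mulrN.
Qed.

(** The mass of the weight, which the added 1 contributes to
    [integral_abel_1cos], is read off from the case u = 0. *)
Lemma Rintegral_abel_cos (u : R) :
  \int[mu]_w (abel s w * cos (2 * pi * w * u)) = s^-1 * cauchy_density (u / s).
Proof.
have E (v : R) : \int[mu]_w abel s w + \int[mu]_w (abel s w * cos (2 * pi * w * v)) =
    (pi * s)^-1 + s^-1 * cauchy_density (v / s).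
  rewrite -RintegralD//; [|exact: integrable_abel|exact: integrable_abel_cos].
  rewrite /Rintegral -[RHS]/(fine _%:E) -integral_abel_1cos//; congr fine.
  by apply: eq_integral => w _; congr EFin; ring.
have := E u; have := E 0; clear E.
under [X in _ + X = _ -> _]eq_Rintegral do rewrite mulr0 cos0 mulr1.
rewrite [cauchy_density (0 / s)]/cauchy_density mul0r expr0n addr0 mulr1 invfM.
by move: (\int[mu]_w _) (\int[mu]_w _) => a b; lra.
Qed.

End abel_fourier.

(** * Abel summation of a Fourier transform *)

Section real_fourier.
Variable R : realType.
Notation mu := (@lebesgue_measure R).

(** The real part of the Fourier transform of p + i q at frequency w. *)
Definition re_fourier (p q : R -> R) (w : R) : R :=
  \int[mu]_u (p u * cos (2 * pi * w * u) + q u * sin (2 * pi * w * u)).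

Lemma measurable_re_fourier_integrand d (T : measurableType d) (p q w u : T -> R) :
  measurable_fun setT p -> measurable_fun setT q ->
  measurable_fun setT w -> measurable_fun setT u ->
  measurable_fun setT (fun z : T =>
    p z * cos (2 * pi * w z * u z) + q z * sin (2 * pi * w z * u z)).
Proof.
move=> mp mq mw mu'.
have mph : measurable_fun setT (fun z => 2 * pi * w z * u z).
  by apply: measurable_funM => //; exact: measurable_funM.
apply: measurable_funD; apply: measurable_funM => //.
  by apply: measurableT_comp mph; apply: continuous_measurable_fun; exact: continuous_cos.
by apply: measurableT_comp mph; apply: continuous_measurable_fun; exact: continuous_sin.
Qed.

Variables p q : R -> R.
Hypotheses (pi_ : mu.-integrable setT (EFin \o p))
           (qi_ : mu.-integrable setT (EFin \o q)).

Let mp : measurable_fun setT p.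
Proof. by apply/measurable_EFinP; case/integrableP : pi_. Qed.
Let mq : measurable_fun setT q.
Proof. by apply/measurable_EFinP; case/integrableP : qi_. Qed.

Lemma integrable_re_fourier_integrand w : mu.-integrable setT
  (fun u => (p u * cos (2 * pi * w * u) + q u * sin (2 * pi * w * u))%:E).
Proof.
apply: integrable_addr; apply: (integrable_mul_bounded (c := 1)) => //.
- exact: measurable_cos_phase.
- by move=> x; exact: cos_max.
- exact: measurable_sin_phase.
- by move=> x; exact: sin_max.
Qed.

Lemma measurable_re_fourier : measurable_fun setT (re_fourier p q).
Proof.
apply: (measurable_Rintegral_section mu (H := fun z : R * R =>
  p z.2 * cos (2 * pi * z.1 * z.2) + q z.2 * sin (2 * pi * z.1 * z.2))).
apply: measurable_re_fourier_integrand => //.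
- exact: (measurableT_comp mp).
- exact: (measurableT_comp mq).
Qed.

Let B := \int[mu]_u (`|p u| + `|q u|).

Let iB : mu.-integrable setT (fun u => (`|p u| + `|q u|)%:E).
Proof.
by apply: integrable_addr; [exact: (integrable_norm pi_)|exact: (integrable_norm qi_)].
Qed.

Lemma re_fourier_integrand_le (c t : R) u : `|c| <= 1 -> `|t| <= 1 ->
  `|p u * c + q u * t| <= `|p u| + `|q u|.
Proof.
move=> c1 t1; apply: (le_trans (ler_normD _ _)); rewrite !normrM.
by apply: lerD; rewrite -[leRHS]mulr1; apply: ler_wpM2l.
Qed.

Lemma normr_re_fourier_le w : `|re_fourier p q w| <= B.
Proof.
apply: le_trans (le_normr_Rintegral _ _) _ => //; first exact: integrable_re_fourier_integrand.
apply: le_Rintegral => //.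
  exact: (integrable_norm (integrable_re_fourier_integrand w)).
by move=> u _; apply: re_fourier_integrand_le; [exact: cos_max|exact: sin_max].
Qed.

Lemma integrable_abel_re_fourier s : 0 < s ->
  mu.-integrable setT (fun w => (abel s w * re_fourier p q w)%:E).
Proof.
move=> s0; apply: (integrable_mul_bounded (c := B) (integrable_abel s0)).
  exact: measurable_re_fourier.
exact: normr_re_fourier_le.
Qed.

(** Fubini: the cosine part of the Abel weight is the Cauchy density, and its
    sine part vanishes by parity, which removes q. *)
Lemma Rintegral_abel_re_fourier s : 0 < s ->
  \int[mu]_w (abel s w * re_fourier p q w) = \int[mu]_u (p u * (s^-1 * cauchy_density (u / s))).
Proof.
move=> s0.
pose H (z : R * R) := abel s z.1 *
  (p z.2 * cos (2 * pi * z.1 * z.2) + q z.2 * sin (2 * pi * z.1 * z.2)).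
have iH : (mu \x mu)%E.-integrable setT (EFin \o H).
  have := integrable_tensor (integrable_abel s0) iB.
  apply: le_integrable => //.
    apply/measurable_EFinP; apply: measurable_funM.
      by apply: (measurableT_comp (@measurable_abel R s)).
    apply: measurable_re_fourier_integrand => //.
    - exact: (measurableT_comp mp).
    - exact: (measurableT_comp mq).
  move=> z _; rewrite lee_fin !normrM; apply: ler_wpM2l => //.
  rewrite [leRHS]ger0_norm ?addr_ge0//.
  by apply: re_fourier_integrand_le; [exact: cos_max|exact: sin_max].
transitivity (\int[mu]_w \int[mu]_u H (w, u)).
  apply: eq_Rintegral => w _; rewrite /H/= RintegralZl//.
  exact: integrable_re_fourier_integrand.
rewrite -Rintegral_prod1// Rintegral_prod2//; apply: eq_Rintegral => u _.
rewrite /H /= -(Rintegral_abel_cos s0).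
transitivity (\int[mu]_w (p u * (abel s w * cos (2 * pi * w * u)) +
                          q u * (abel s w * sin (2 * pi * w * u)))).
  by apply: eq_Rintegral => w _; ring.
rewrite RintegralD//.
- rewrite RintegralZl//; last exact: integrable_abel_cos.
  rewrite RintegralZl//; last exact: integrable_abel_sin.
  by rewrite Rintegral_abel_sin// mulr0 addr0.
- by apply: integrable_scaler; exact: integrable_abel_cos.
- by apply: integrable_scaler; exact: integrable_abel_sin.
Qed.

Lemma integrable_poisson s : 0 < s ->
  mu.-integrable setT (fun u => (p u * (s^-1 * cauchy_density (u / s)))%:E).
Proof.
move=> s0; apply: (integrable_mul_bounded (c := s^-1 * pi^-1)) => //.
  apply: measurable_funM => //.
  have mc : measurable_fun setT (@cauchy_density R).
    by apply: continuous_measurable_fun; exact: continuous_cauchy_density.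
  by apply: (measurableT_comp mc); exact: measurable_funM.
move=> u; rewrite ger0_norm; last by rewrite mulr_ge0 ?cauchy_density_ge0// invr_ge0 ltW.
apply: ler_wpM2l; first by rewrite invr_ge0 ltW.
rewrite /cauchy_density lef_pV2 ?posrE ?mulr_gt0 ?pi_gt0// ?ltr_wpDr ?sqr_ge0//.
by rewrite ler_peMr ?pi_ge0// lerDl sqr_ge0.
Qed.

Lemma Rintegral_poisson_scale s : 0 < s ->
  \int[mu]_u (p u * (s^-1 * cauchy_density (u / s))) = \int[mu]_v (p (s * v) * cauchy_density v).
Proof.
move=> s0; have iP := integrable_poisson s0.
rewrite (Rintegral_scale s0 iP) -RintegralZl//; last exact: (integrable_comp_scale s0 iP).
apply: eq_Rintegral => v _; rewrite [s * v / s]mulrAC divff ?gt_eqF// mul1r.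
by field; rewrite gt_eqF.
Qed.


Variable c : R.
Hypothesis pc : forall u, `|p u| <= c.

Let c0 : 0 <= c. Proof. exact: le_trans (pc 0). Qed.

Let mk s : measurable_fun setT (fun v : R => p (s * v) * cauchy_density v).
Proof.
apply: measurable_funM.
  by apply: (measurableT_comp mp); exact: measurable_funM.
by apply: continuous_measurable_fun; exact: continuous_cauchy_density.
Qed.

Let ck s v : `|p (s * v) * cauchy_density v| <= c * cauchy_density v.
Proof.
rewrite normrM [X in _ * X]ger0_norm ?cauchy_density_ge0//.
by apply: ler_wpM2r; first exact: cauchy_density_ge0.
Qed.

Let ick : mu.-integrable setT (EFin \o (fun v => c * cauchy_density v)).
Proof. by apply: integrable_scaler; exact: integrable_cauchy_density. Qed.

Lemma Rintegral_abel_re_fourier_le s : 0 < s -> \int[mu]_w (abel s w * re_fourier p q w) <= c.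
Proof.
move=> s0; rewrite Rintegral_abel_re_fourier// Rintegral_poisson_scale//.
have Ec : \int[mu]_v (c * cauchy_density v) = c.
  rewrite RintegralZl//; last exact: integrable_cauchy_density.
  by rewrite /Rintegral integral_cauchy_density mulr1.
rewrite -[leRHS]Ec; apply: le_Rintegral => //.
  apply: le_integrable ick => //; first by apply/measurable_EFinP; exact: mk.
  move=> v _ /=; rewrite lee_fin [leRHS]ger0_norm ?mulr_ge0 ?cauchy_density_ge0//.
by move=> v _; apply: le_trans (ck s v); exact: ler_norm.
Qed.

(** A probability density averages p to at most c; for a nonnegative transform
    the Abel weights increase to 1 and monotone convergence applies. *)
Lemma integral_re_fourier_le : (forall w, 0 <= re_fourier p q w) ->
  (\int[mu]_w (re_fourier p q w)%:E <= c%:E)%E.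
Proof.
move=> r0.
have s0 n : 0 < harmonic n :> R by rewrite /harmonic/= invr_gt0.
pose g n w := (abel (harmonic n) w * re_fourier p q w)%:E.
have gE w : limn (g ^~ w) = (re_fourier p q w)%:E.
  apply/cvg_lim => //; apply: cvg_EFin; first by near=> n.
  rewrite [X in _ --> X](_ : _ = abel 0 w * re_fourier p q w); last first.
    by rewrite /abel mulr0 mul0r oppr0 expR0 mul1r.
  apply: cvgM; last exact: cvg_cst.
  apply: (cvg_comp harmonic (fun s => abel s w)); first exact: cvg_harmonic.
  apply: (continuous_comp (f := fun s : R => - (2 * pi * s * `|w|))); last exact: continuous_expR.
  by apply: cvgN; apply: cvgM; [apply: cvgM; [exact: cvg_cst|exact: cvg_id]|exact: cvg_cst].
have mg n : measurable_fun setT (g n).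
  apply/measurable_EFinP; apply: measurable_funM; last exact: measurable_re_fourier.
  exact: measurable_abel.
have ndg w : {homo g ^~ w : m n / (m <= n)%N >-> (m <= n)%E}.
  move=> m n mn; rewrite lee_fin; apply: ler_wpM2r => //.
  rewrite /abel ler_expR lerN2; apply: ler_wpM2r => //; apply: ler_wpM2l.
    by rewrite mulr_ge0// pi_ge0.
  by rewrite /harmonic/= lef_pV2 ?posrE// ler_nat.
under eq_integral do rewrite -gE.
rewrite monotone_convergence//.
  apply: lime_le.
    apply: ereal_nondecreasing_is_cvgn => m n mn; apply: ge0_le_integral => //.
    - by move=> w _; rewrite lee_fin mulr_ge0 ?abel_ge0.
    - exact: mg.
    - exact: mg.
    - by move=> w _; exact: ndg.
  near=> n; rewrite /g.
  have -> : (\int[mu]_x (abel (harmonic n) x * re_fourier p q x)%:E =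
     (\int[mu]_x (abel (harmonic n) x * re_fourier p q x))%:E)%E.
    by rewrite /Rintegral fineK//; apply: integrable_fin_num => //; exact: integrable_abel_re_fourier.
  by rewrite lee_fin; exact: Rintegral_abel_re_fourier_le.
by move=> n w _; rewrite lee_fin mulr_ge0 ?abel_ge0.
Unshelve. all: by end_near. Qed.

(** Fourier inversion at 0, in the form of an inequality: the Abel means tend to
    p 0 by dominated convergence and are at most the integral of the modulus.
    The integral may be infinite. *)
Lemma ge0_le_integral_re_fourier : {for 0, continuous p} ->
  ((p 0)%:E <= \int[mu]_w `|re_fourier p q w|%:E)%E.
Proof.
move=> p_cont.
have s0 n : 0 < harmonic n :> R by rewrite /harmonic/= invr_gt0.
have E0 : (\int[mu]_v (p 0 * cauchy_density v)%:E = (p 0)%:E)%E.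
  under eq_integral do rewrite EFinM.
  rewrite integralZl//; last exact: integrable_cauchy_density.
  by rewrite integral_cauchy_density mule1.
have cvE : (\int[mu]_v (p (harmonic n * v) * cauchy_density v)%:E @[n --> \oo] -->
   \int[mu]_v (p 0 * cauchy_density v)%:E)%E.
  apply: (@dominated_cvg _ _ _ mu _ _ (fun n v => (p (harmonic n * v) * cauchy_density v)%:E)
    _ (EFin \o (fun v => c * cauchy_density v))) => //.
  - by move=> n; apply/measurable_EFinP; exact: mk.
  - move=> v _; apply: cvg_EFin; first by near=> n.
    apply: cvgM; last exact: cvg_cst.
    have hv : harmonic n * v @[n --> \oo] --> (0 : R).
      rewrite -(mul0r v); apply: cvgM; last exact: cvg_cst.
      exact: cvg_harmonic.
    exact: (cvg_comp _ p hv p_cont).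
  - by move=> n v _; rewrite lee_fin; exact: ck.
rewrite -E0 -(cvg_lim _ cvE)//; apply: lime_le; first by apply/cvg_ex; eexists; exact: cvE.
near=> n.
have ip n' : mu.-integrable setT (EFin \o (fun v => p (harmonic n' * v) * cauchy_density v)).
  apply: le_integrable ick => //; first by apply/measurable_EFinP; exact: mk.
  move=> v _ /=; rewrite lee_fin [leRHS]ger0_norm ?mulr_ge0 ?cauchy_density_ge0//.
have -> : (\int[mu]_v (p (harmonic n * v) * cauchy_density v)%:E =
   (\int[mu]_w (abel (harmonic n) w * re_fourier p q w))%:E)%E.
  rewrite Rintegral_abel_re_fourier// Rintegral_poisson_scale//.
  by rewrite /Rintegral fineK//; apply: integrable_fin_num => //; exact: ip.
have ia := integrable_abel_re_fourier (s0 n).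
apply: (@le_trans _ _ (\int[mu]_w `|abel (harmonic n) w * re_fourier p q w|%:E)%E).
  rewrite (_ : (\int[mu]_w `|_|%:E)%E = (\int[mu]_w `|abel (harmonic n) w * re_fourier p q w|)%:E); last first.
    by rewrite /Rintegral fineK//; apply: integrable_fin_num => //; exact: (integrable_norm ia).
  rewrite lee_fin; apply: le_trans (le_normr_Rintegral _ _) => //.
  exact: ler_norm.
have mr := measurable_re_fourier.
apply: ge0_le_integral => //.
- apply/measurable_EFinP; apply: measurableT_comp => //; apply: measurable_funM => //.
  exact: measurable_abel.
- by apply/measurable_EFinP; exact: measurableT_comp.
- move=> w _; rewrite lee_fin normrM ger0_norm ?abel_ge0// ler_piMl//.
  exact: abel_le1.
Unshelve. all: by end_near. Qed.

End real_fourier.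

(** * Power spectrum, Wigner marginals, Bessel and Plancherel *)

Section spectrum.
Variable R : realType.
Notation mu := (@lebesgue_measure R).
Implicit Types a b p q : R -> R.

(** Closed under truncation, and contained in every L^p; products and
    correlations of such functions are integrable. *)
Definition integrable_bounded (h : R -> R) :=
  mu.-integrable setT (EFin \o h) /\ exists c, forall x, `|h x| <= c.

(** The square modulus of the Fourier transform of a + i b: its imaginary part
    is the real part of the transform of b - i a. *)
Definition power_spectrum a b (w : R) := re_fourier a b w ^+ 2 + re_fourier b (fun x => - a x) w ^+ 2.

Lemma power_spectrum_ge0 a b w : 0 <= power_spectrum a b w.
Proof. by rewrite addr_ge0 ?sqr_ge0. Qed.

Lemma integrable_bounded_measurable h : integrable_bounded h -> measurable_fun setT h.
Proof. by move=> [/integrableP[/measurable_EFinP]]. Qed.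

Lemma integrable_boundedN h : integrable_bounded h -> integrable_bounded (fun x => - h x).
Proof.
move=> [ih [c hc]]; split; last by exists c => x; rewrite normrN.
exact: (integrableN ih).
Qed.

Lemma integrable_boundedB g h : integrable_bounded g -> integrable_bounded h ->
  integrable_bounded (fun x => g x - h x).
Proof.
move=> [ig [c gc]] [ih [d hd]]; split; first exact: (integrableB _ ig ih).
by exists (c + d) => x; apply: le_trans (ler_normB _ _) (lerD _ _).
Qed.

Lemma integrable_boundedM1 h (k : R -> R) : integrable_bounded h -> measurable_fun setT k ->
  (forall x, `|k x| <= 1) -> integrable_bounded (fun x => h x * k x).
Proof.
move=> [ih [c hc]] mk k1; split; first exact: (integrable_mul_bounded ih mk k1).
exists c => x; rewrite normrM; apply: le_trans (hc x).
by rewrite -[leRHS]mulr1; apply: ler_wpM2l.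
Qed.

Lemma integrable_bounded_mul g h : integrable_bounded g -> integrable_bounded h ->
  mu.-integrable setT (fun x => (g x * h x)%:E).
Proof.
move=> [ig _] hb; have [_ [c hc]] := hb.
by apply: (integrable_mul_bounded ig _ hc); exact: integrable_bounded_measurable.
Qed.

Lemma integrable_bounded_cross g h u : integrable_bounded g -> integrable_bounded h ->
  mu.-integrable setT (fun x => (g (x + u) * h x)%:E).
Proof.
move=> [ig [c gc]] [ih [d hd]].
under eq_fun do rewrite mulrC.
apply: (integrable_mul_bounded (c := c) ih) => //.
case/integrableP : ig => /measurable_EFinP mg _.
by apply: (measurableT_comp mg); exact: measurable_funD.
Qed.

Lemma re_fourierB a1 b1 a2 b2 w : mu.-integrable setT (EFin \o a1) -> mu.-integrable setT (EFin \o b1) ->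
  mu.-integrable setT (EFin \o a2) -> mu.-integrable setT (EFin \o b2) ->
  re_fourier (fun x => a1 x - a2 x) (fun x => b1 x - b2 x) w = re_fourier a1 b1 w - re_fourier a2 b2 w.
Proof.
move=> ia1 ib1 ia2 ib2; rewrite /re_fourier -RintegralB//; try exact: integrable_re_fourier_integrand.
by apply: eq_Rintegral => x _; ring.
Qed.

(** Linearity of the transform and |z - z'|^2 <= 2 |z|^2 + 2 |z'|^2. *)
Lemma power_spectrumB_le a1 b1 a2 b2 w : integrable_bounded a1 -> integrable_bounded b1 ->
  integrable_bounded a2 -> integrable_bounded b2 ->
  power_spectrum (fun x => a1 x - a2 x) (fun x => b1 x - b2 x) w <=
  2 * power_spectrum a1 b1 w + 2 * power_spectrum a2 b2 w.
Proof.
move=> [ia1 _] [ib1 _] [ia2 _] [ib2 _]; rewrite /power_spectrum re_fourierB//.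
have -> : (fun x => - (a1 x - a2 x)) = (fun x => (- a1 x) - (- a2 x)).
  by apply/funext => x; ring.
have iN1 := integrableN ia1; have iN2 := integrableN ia2.
rewrite (re_fourierB w ib1 iN1 ib2 iN2).
set x := re_fourier a1 _ _; set y := re_fourier a2 _ _; set z := re_fourier b1 _ _; set t := re_fourier b2 _ _.
have := sqr_ge0 (x + y); have := sqr_ge0 (z + t).
rewrite !expr2 => h1 h2; lra.
Qed.

Lemma measurable_power_spectrum a b : mu.-integrable setT (EFin \o a) -> mu.-integrable setT (EFin \o b) ->
  measurable_fun setT (power_spectrum a b).
Proof.
move=> ia ib; have iN := integrableN ia.
by apply: measurable_funD; apply: measurable_funX; exact: measurable_re_fourier.
Qed.

End spectrum.

Section wigner.
Variable R : realType.
Notation mu := (@lebesgue_measure R).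
Variables a b : R -> R.
Hypotheses (ha : integrable_bounded a) (hb : integrable_bounded b).

(** With g = a + i b, [prod_re] and [prod_im] are the real and imaginary parts of
    g(s) times the conjugate of g(t). *)
Definition prod_re (s t : R) := a s * a t + b s * b t.
Definition prod_im (s t : R) := b s * a t - a s * b t.

Let ma : measurable_fun setT a. Proof. exact: integrable_bounded_measurable. Qed.
Let mb : measurable_fun setT b. Proof. exact: integrable_bounded_measurable. Qed.

Lemma measurable_prod_re d (T : measurableType d) (f g : T -> R) : measurable_fun setT f ->
  measurable_fun setT g -> measurable_fun setT (fun z => prod_re (f z) (g z)).
Proof.
move=> mf mg; apply: measurable_funD; apply: measurable_funM.
- exact: (measurableT_comp ma mf).
- exact: (measurableT_comp ma mg).
- exact: (measurableT_comp mb mf).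
- exact: (measurableT_comp mb mg).
Qed.

Lemma measurable_prod_im d (T : measurableType d) (f g : T -> R) : measurable_fun setT f ->
  measurable_fun setT g -> measurable_fun setT (fun z => prod_im (f z) (g z)).
Proof.
move=> mf mg; apply: measurable_funB; apply: measurable_funM.
- exact: (measurableT_comp mb mf).
- exact: (measurableT_comp ma mg).
- exact: (measurableT_comp ma mf).
- exact: (measurableT_comp mb mg).
Qed.

Let rot (a b : R -> R) w y := a y * cos (2 * pi * w * y) + b y * sin (2 * pi * w * y).

(** The real part of an identity: the product of g(s), the conjugate of g(t) and
    e^(-2 pi i w (s - t)) is G(s) times the conjugate of G(t), where
    G(y) = g(y) e^(-2 pi i w y). *)
Lemma cross_rot w s t :
  prod_re s t * cos (2 * pi * w * (s - t)) + prod_im s t * sin (2 * pi * w * (s - t)) =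
  rot a b w s * rot a b w t + rot b (fun x => - a x) w s * rot b (fun x => - a x) w t.
Proof. by rewrite mulrBr cosB sinB /rot /prod_re /prod_im; ring. Qed.

Notation mu2 := (mu \x mu)%E.

Let iab w : mu.-integrable setT (EFin \o rot a b w).
Proof. by apply: integrable_re_fourier_integrand; [case: ha|case: hb]. Qed.

Let iba w : mu.-integrable setT (EFin \o rot b (fun x => - a x) w).
Proof. by apply: integrable_re_fourier_integrand; [case: hb|case: (integrable_boundedN ha)]. Qed.

Lemma integrable_cross w : mu2.-integrable setT (EFin \o (fun z : R * R =>
  prod_re z.1 z.2 * cos (2 * pi * w * (z.1 - z.2)) + prod_im z.1 z.2 * sin (2 * pi * w * (z.1 - z.2)))).
Proof.
under eq_fun do rewrite cross_rot.
exact: (integrableD measurableT (integrable_tensor (iab w) (iab w)) (integrable_tensor (iba w) (iba w))).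
Qed.

Lemma Rintegral_cross w : \int[mu2]_z
  (prod_re z.1 z.2 * cos (2 * pi * w * (z.1 - z.2)) + prod_im z.1 z.2 * sin (2 * pi * w * (z.1 - z.2))) =
  power_spectrum a b w.
Proof.
under eq_Rintegral do rewrite cross_rot.
rewrite RintegralD//; [|exact: integrable_tensor|exact: integrable_tensor].
by rewrite !Rintegral_tensor// /power_spectrum !expr2.
Qed.

Lemma integrable_prod_re : mu2.-integrable setT (fun z : R * R => (prod_re z.1 z.2)%:E).
Proof.
case: ha => ia _; case: hb => ib _.
exact: (integrableD measurableT (integrable_tensor ia ia) (integrable_tensor ib ib)).
Qed.

Lemma integrable_prod_im : mu2.-integrable setT (fun z : R * R => (prod_im z.1 z.2)%:E).
Proof.
case: ha => ia _; case: hb => ib _.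
exact: (integrableB measurableT (integrable_tensor ib ia) (integrable_tensor ia ib)).
Qed.

Variable l : R -> R.
Hypothesis ml : measurable_fun setT l.

(** For l(u) = log (u / (e^u - 1)) this is the real part of the affine Wigner
    distribution at (w, e^x).  For l = 0 it is a distribution with the same
    frequency marginal, which gives the autocorrelation of a + i b. *)
Definition wigner_re (w x : R) : R :=
  re_fourier (fun u => prod_re (x + l u + u) (x + l u)) (fun u => prod_im (x + l u + u) (x + l u)) w.

Lemma measurable_wigner_re : measurable_fun setT (fun z : R * R => wigner_re z.1 z.2).
Proof.
have mlu : measurable_fun setT (fun z : (R * R) * R => z.1.2 + l z.2).
  apply: measurable_funD; first exact: measurableT_comp.
  exact: (measurableT_comp ml).
have mluu : measurable_fun setT (fun z : (R * R) * R => z.1.2 + l z.2 + z.2).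
  exact: measurable_funD.
apply: (measurable_Rintegral_section mu (H := fun z : (R * R) * R =>
  prod_re (z.1.2 + l z.2 + z.2) (z.1.2 + l z.2) * cos (2 * pi * z.1.1 * z.2) +
  prod_im (z.1.2 + l z.2 + z.2) (z.1.2 + l z.2) * sin (2 * pi * z.1.1 * z.2))).
apply: measurable_re_fourier_integrand => //.
- exact: measurable_prod_re.
- exact: measurable_prod_im.
- exact: measurableT_comp.
Qed.

Let K w (z : R * R) := prod_re (z.1 + l z.2 + z.2) (z.1 + l z.2) * cos (2 * pi * w * z.2) +
  prod_im (z.1 + l z.2 + z.2) (z.1 + l z.2) * sin (2 * pi * w * z.2).

Let KE w : K w = (fun z : R * R =>
  prod_re z.1 z.2 * cos (2 * pi * w * (z.1 - z.2)) + prod_im z.1 z.2 * sin (2 * pi * w * (z.1 - z.2)))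
  \o shear l.
Proof. by apply/funext => -[x u] /=; rewrite /K/= [x + l u + u - _]addrAC subrr add0r. Qed.

Let iK w : mu2.-integrable setT (EFin \o K w).
Proof. by rewrite KE; exact: (integrable_preserving (shear_preserving ml) (integrable_cross w)). Qed.

Let IK w : \int[mu2]_z K w z = power_spectrum a b w.
Proof.
rewrite -Rintegral_cross KE.
have /integrableP[/measurable_EFinP mC _] := integrable_cross w.
by rewrite -(Rintegral_preserving (shear_preserving ml) mC).
Qed.

Lemma integrable_wigner_re w : mu.-integrable setT (fun x => (wigner_re w x)%:E).
Proof. exact: (integrable_Rintegral_section (iK w)). Qed.

(** The frequency marginal: after the area-preserving change of variables, the
    double integral over x and u factors by [cross_rot]. *)
Lemma Rintegral_wigner_re w : \int[mu]_x wigner_re w x = power_spectrum a b w.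
Proof. by rewrite -IK (Rintegral_prod1 (iK w)). Qed.

Definition autocor (u : R) := \int[mu]_x prod_re (x + l u + u) (x + l u).
Definition crosscor (u : R) := \int[mu]_x prod_im (x + l u + u) (x + l u).

Let iacs : mu2.-integrable setT (EFin \o (fun z : R * R => prod_re (z.1 + l z.2 + z.2) (z.1 + l z.2))).
Proof. exact: (integrable_preserving (shear_preserving ml) (f := fun z : R * R => prod_re z.1 z.2) integrable_prod_re). Qed.

Let iccs : mu2.-integrable setT (EFin \o (fun z : R * R => prod_im (z.1 + l z.2 + z.2) (z.1 + l z.2))).
Proof. exact: (integrable_preserving (shear_preserving ml) (f := fun z : R * R => prod_im z.1 z.2) integrable_prod_im). Qed.

Lemma integrable_autocor : mu.-integrable setT (EFin \o autocor).
Proof. exact: (integrable_Rintegral_section2 iacs). Qed.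

Lemma integrable_crosscor : mu.-integrable setT (EFin \o crosscor).
Proof. exact: (integrable_Rintegral_section2 iccs). Qed.

Let integrable_shift_mul (g k : R -> R) s t : integrable_bounded g -> integrable_bounded k ->
  mu.-integrable setT (fun x => (g (x + s) * k (x + t))%:E).
Proof.
move=> hg hk; have := integrable_preserving (lebesgue_measure_translation t)
  (integrable_bounded_cross (s - t) hg hk).
apply: eq_integrable => // x _ /=; congr (g _ * _)%:E.
by rewrite -addrA subrKC.
Qed.

Lemma integrable_prod_re_shift s t : mu.-integrable setT (fun x => (prod_re (x + s) (x + t))%:E).
Proof.
exact: (integrableD measurableT (integrable_shift_mul s t ha ha) (integrable_shift_mul s t hb hb)).
Qed.

Lemma integrable_prod_im_shift s t : mu.-integrable setT (fun x => (prod_im (x + s) (x + t))%:E).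
Proof.
exact: (integrableB measurableT (integrable_shift_mul s t hb ha) (integrable_shift_mul s t ha hb)).
Qed.

(** The same double integral as for the frequency marginal, with x integrated
    first. *)
Lemma re_fourier_autocor w : re_fourier autocor crosscor w = power_spectrum a b w.
Proof.
rewrite -IK (Rintegral_prod2 (iK w)) /re_fourier; apply: eq_Rintegral => u _ /=.
have i1 : mu.-integrable setT (fun x => (prod_re (x + l u + u) (x + l u))%:E).
  by have := integrable_prod_re_shift (l u + u) (l u); under eq_fun do rewrite addrA.
have i2 : mu.-integrable setT (fun x => (prod_im (x + l u + u) (x + l u))%:E).
  by have := integrable_prod_im_shift (l u + u) (l u); under eq_fun do rewrite addrA.
rewrite /autocor /crosscor -RintegralZr// -RintegralZr// -RintegralD//.
- apply: (integrable_mul_bounded (c := 1)) => // x; exact: cos_max.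
- apply: (integrable_mul_bounded (c := 1)) => // x; exact: sin_max.
Qed.

Definition energy : R := \int[mu]_x (a x ^+ 2 + b x ^+ 2).

Lemma integrable_energy : mu.-integrable setT (fun x => (a x ^+ 2 + b x ^+ 2)%:E).
Proof.
by have := integrableD measurableT (integrable_bounded_mul ha ha) (integrable_bounded_mul hb hb).
Qed.

Lemma normr_autocor_le u : `|autocor u| <= energy.
Proof.
pose e x := a x ^+ 2 + b x ^+ 2.
have me : measurable_fun setT e.
  by apply/measurable_EFinP; case/integrableP : integrable_energy.
have ie (t : R) : mu.-integrable setT (fun x => (e (x + t))%:E).
  exact: (integrable_preserving (lebesgue_measure_translation t) integrable_energy).
have Ie (t : R) : \int[mu]_x e (x + t) = energy.
  exact: (Rintegral_preserving (lebesgue_measure_translation t) me).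
have i1 : mu.-integrable setT (fun x => (prod_re (x + l u + u) (x + l u))%:E).
  by have := integrable_prod_re_shift (l u + u) (l u); under eq_fun do rewrite addrA.
apply: le_trans (le_normr_Rintegral _ _) _ => //.
have -> : energy = \int[mu]_x (2^-1 * (e (x + (l u + u)) + e (x + l u))).
  rewrite RintegralZl//; last exact: (integrable_addr (ie _) (ie _)).
  have E2 : \int[mu]_x (e (x + (l u + u)) + e (x + l u)) = energy + energy.
    have := RintegralD measurableT (ie (l u + u)) (ie (l u)).
    by move=> /= ->; rewrite (Ie (l u + u)) (Ie (l u)).
  by rewrite E2; field.
apply: le_Rintegral => //.
- exact: (integrable_norm i1).
- exact: (integrable_scaler _ (integrable_addr (ie _) (ie _))).
move=> x _; rewrite /e /prod_re [x + (_ + _)]addrA ler_norml.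
set p := a _; set q := a _; set r := b _; set s := b _.
have := sqr_ge0 (p - q); have := sqr_ge0 (p + q); have := sqr_ge0 (r - s).
have := sqr_ge0 (r + s); rewrite !expr2 => *; apply/andP; split; lra.
Qed.

(** Bessel's inequality: the autocorrelation is bounded by the energy and has a
    nonnegative transform. *)
Lemma integral_power_spectrum_le : (\int[mu]_w (power_spectrum a b w)%:E <= energy%:E)%E.
Proof.
under eq_integral do rewrite -re_fourier_autocor.
apply: integral_re_fourier_le.
- exact: integrable_autocor.
- exact: integrable_crosscor.
- exact: normr_autocor_le.
- by move=> w; rewrite re_fourier_autocor power_spectrum_ge0.
Qed.

Hypotheses (ca : continuous a) (cb : continuous b).

Lemma continuous_autocor0 : l = cst 0 -> continuous autocor.
Proof.
move=> l0 u0; have [ia [A aA]] := ha; have [ib [B bB]] := hb.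
have A0 : 0 <= A by apply: le_trans (aA 0).
have B0 : 0 <= B by apply: le_trans (bB 0).
have ig : mu.-integrable setT (EFin \o (fun x => A * `|a x| + B * `|b x|)).
  by apply: integrable_addr; apply: integrable_scaler; exact: integrable_norm.
have cu (u v : R) := @continuity_under_integral R _ _ mu
  (fun u x => prod_re (x + l u + u) (x + l u)) setT measurableT u v.
apply: (cu (u0 - 1) (u0 + 1) _ _ _ ig).
- move=> u _; have := integrable_prod_re_shift (l u + u) (l u).
  by under eq_fun do rewrite addrA.
- apply: aeW => y _ u _; rewrite l0 /=.
  under eq_fun do rewrite addr0.
  have c1 : {for u, continuous (fun v => y + v)}.
    by apply: cvgD; [exact: cvg_cst|exact: cvg_id].
  have c2 : {for u, continuous (fun v => a (y + v))} := continuous_comp c1 (@ca _).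
  have c3 : {for u, continuous (fun v => b (y + v))} := continuous_comp c1 (@cb _).
  exact: (cvgD (cvgM c2 (cvg_cst _)) (cvgM c3 (cvg_cst _))).
- move=> u _; apply: aeW => y _; rewrite l0/= addr0 /prod_re.
  apply: (le_trans (ler_normD _ _)); rewrite !normrM.
  by apply: lerD; apply: ler_wpM2r.
- by rewrite inE/= in_itv/=; apply/andP; split; lra.
Qed.

(** Plancherel's inequality: the energy is the autocorrelation at 0. *)
Lemma energy_le_integral_power_spectrum : l = cst 0 -> (energy%:E <= \int[mu]_w (power_spectrum a b w)%:E)%E.
Proof.
move=> l0.
have := ge0_le_integral_re_fourier integrable_autocor integrable_crosscor normr_autocor_le
  (@continuous_autocor0 l0 0).
under eq_integral do rewrite re_fourier_autocor ger0_norm ?power_spectrum_ge0//.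
suff -> : energy = autocor 0 by [].
by apply: eq_Rintegral => x _; rewrite l0 /= !addr0 /prod_re !expr2.
Qed.

(** The space marginal: at u = 0 both arguments of the product are x.  By Fubini,
    almost every x-section is integrable in u. *)
Lemma ae_le_integral_wigner_re : l 0 = 0 -> {for 0, continuous l} ->
  {ae mu, forall x, ((a x ^+ 2 + b x ^+ 2)%:E <= \int[mu]_w `|wigner_re w x|%:E)%E}.
Proof.
move=> l0 cl; move: (ae_integrable1 iacs) (ae_integrable1 iccs).
apply: filterS2 => x ix jx.
have [ia [A aA]] := ha; have [ib [B bB]] := hb.
have E : prod_re (x + l 0 + 0) (x + l 0) = a x ^+ 2 + b x ^+ 2.
  by rewrite l0 !addr0 /prod_re !expr2.
rewrite -E; apply: (@ge0_le_integral_re_fourier R (fun u => prod_re (x + l u + u) (x + l u))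
  (fun u => prod_im (x + l u + u) (x + l u)) ix jx (A * A + B * B)).
- move=> u; apply: le_trans (ler_normD _ _) _; rewrite !normrM.
  by apply: lerD; apply: ler_pM.
- have c1 : {for 0, continuous (fun u => x + l u)}.
    by apply: cvgD; [exact: cvg_cst|exact: cl].
  have c2 : {for 0, continuous (fun u => x + l u + u)}.
    by apply: cvgD => //; exact: cvg_id.
  have a1 : {for 0, continuous (fun u => a (x + l u))} := continuous_comp c1 (@ca _).
  have b1 : {for 0, continuous (fun u => b (x + l u))} := continuous_comp c1 (@cb _).
  have a2 : {for 0, continuous (fun u => a (x + l u + u))} := continuous_comp c2 (@ca _).
  have b2 : {for 0, continuous (fun u => b (x + l u + u))} := continuous_comp c2 (@cb _).
  exact: (cvgD (cvgM a2 a1) (cvgM b2 b1)).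
Qed.

End wigner.


(** * Logarithmic coordinates *)

Section haar_log.
Variable R : realType.
Notation mu := (@lebesgue_measure R).

Lemma RposE (r : R) : Rpos R r = (0 < r) :> Prop.
Proof. by rewrite /Rpos /= in_itv/= andbT. Qed.

Lemma integral_inv (c d : R) : 0 < c -> c < d ->
  (\int[mu]_(r in `]c, d]) (r^-1)%:E = (ln d - ln c)%:E)%E.
Proof.
move=> c0 cd.
have minv : measurable_fun `]c, d]%classic (fun r : R => (r^-1)%:E).
  apply/measurable_EFinP; apply: (measurable_funS (@measurable_Rpos R)).
    by move=> r /=; rewrite RposE in_itv/= => /andP[/(lt_trans c0)].
  apply: open_continuous_measurable_fun; first exact: interval_open.
  move=> r; rewrite inE RposE => r0.
  by apply: inv_continuous; rewrite gt_eqF.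
rewrite integral_itv_obnd_cbnd// (@continuous_FTC2 _ _ (@ln R))//.
- apply: continuous_in_subspaceT => r; rewrite inE/= in_itv/= => /andP[cr _].
  by apply: inv_continuous; rewrite gt_eqF// (lt_le_trans c0).
- split.
  + move=> r; rewrite in_itv/= => /andP[cr _].
    by have /(_ (lt_trans c0 cr)) := @is_derive1_ln R r => H; exact: ex_derive.
  + by apply: cvg_at_right_filter; exact: continuous_ln.
  + by apply: cvg_at_left_filter; apply: continuous_ln; exact: lt_trans cd.
- move=> r; rewrite in_itv/= => /andP[cr _]; rewrite derive1E.
  by have /(_ (lt_trans c0 cr)) := @is_derive1_ln R r => H; exact: derive_val.
Qed.

Lemma haar_RposC (A : set R) : A `&` Rpos R = set0 -> haar A = 0%E.
Proof. by move=> A0; rewrite /haar A0 integral_set0. Qed.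

(** It suffices to compare on intervals, where both sides are a difference of
    logarithms. *)
Lemma haar_ln : measure_preserving (@haar R) mu (@ln R).
Proof.
have mphi : measurable_fun setT (@ln R) by exact: measurable_ln.
split => // A mA.
pose phi : measurableTypeR R -> measurableTypeR R := @ln R.
apply/esym; apply: (@lebesgue_measure_unique _ (pushforward (@haar R) phi)) => // _ [[c d] _ <-] /=.
rewrite /pushforward /haar.
rewrite (_ : _ `&` _ = `]expR c, expR d]%classic); last first.
  apply/seteqP; split => r /=; rewrite /phi.
    move=> [/= + r0]; rewrite RposE in r0.
    by rewrite !in_itv/= -ltr_expR -ler_expR lnK.
  rewrite !in_itv/= => /andP[cr rd]; have r0 : 0 < r := lt_trans (expR_gt0 _) cr.
  split; last by rewrite RposE.
  change (is_true (ln r \in `]c, d])).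
  by rewrite in_itv/= -ltr_expR -ler_expR lnK// cr rd.
rewrite lebesgue_measure_itv/= lte_fin; case: ifPn => cd.
  by rewrite integral_inv ?expR_gt0 ?ltr_expR// !expRK.
by rewrite set_itv_ge ?integral_set0// bnd_simp ltr_expR.
Qed.

Lemma ge0_integral_haar (f : R -> \bar R) : measurable_fun setT f -> (forall y, 0 <= f y)%E ->
  (\int[@haar R]_(r in Rpos R) f (ln r) = \int[mu]_x f x)%E.
Proof.
move=> mf f0; rewrite -(ge0_integral_preserving haar_ln mf f0).
have N0 : haar (~` Rpos R) = 0%E by apply: haar_RposC; rewrite setICl.
have mN : measurable (~` Rpos R) by apply: measurableC; exact: measurable_Rpos.
have mfl : measurable_fun setT (fun r => f (@ln R r)) := measurableT_comp mf (@measurable_ln R).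
rewrite [RHS](@ge0_negligible_integral _ _ _ (@haar R) setT (~` Rpos R) _ mN measurableT mfl _ N0)//.
by rewrite setTD setCK.
Qed.

End haar_log.

Section affine_change.
Variable R : realType.

(** The logarithm of u / (e^u - 1); as a difference of two logarithms it takes at
    the origin the value 0, which is its limit there. *)
Definition logtodd (u : R) : R := ln `|u| - ln `|expR u - 1|.

Lemma measurable_logtodd : measurable_fun setT logtodd.
Proof.
have mln := @measurable_ln R.
apply: measurable_funB; apply: (measurableT_comp mln) => //.
by apply: measurableT_comp => //; apply: measurable_funB => //; exact: measurable_expR.
Qed.

Lemma logtodd0 : logtodd 0 = 0.
Proof. by rewrite /logtodd expR0 subrr normr0 subrr. Qed.

Lemma expRB1_ratio_gt0 (u : R) : u != 0 -> 0 < (expR u - 1) / u.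
Proof.
move=> u0; have [u_lt0|u_gt0|/eqP] := ltgtP u 0; last by rewrite (negbTE u0).
  by rewrite nmulr_lgt0 ?invr_lt0// subr_lt0 expR_lt1.
by rewrite divr_gt0// subr_gt0 expR_gt1.
Qed.

Lemma logtoddE u : u != 0 -> logtodd u = - ln ((expR u - 1) / u).
Proof.
move=> u0; have h := expRB1_ratio_gt0 u0.
have e0 : expR u - 1 != 0 by apply: contraTneq h => ->; rewrite mul0r ltxx.
rewrite -(gtr0_norm h) normrM normfV ln_div ?posrE ?normr_gt0//.
by rewrite /logtodd opprB.
Qed.

Lemma expR_logtodd u : u != 0 -> expR (logtodd u) = u / (expR u - 1).
Proof.
move=> u0; rewrite logtoddE// expRN lnK; last by rewrite posrE; exact: expRB1_ratio_gt0.
by rewrite invf_div.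
Qed.

(** The ratio (e^u - 1) / u tends to the derivative of the exponential at 0. *)
Lemma continuous_logtodd0 : {for 0, continuous logtodd}.
Proof.
apply/continuous_withinNx; rewrite logtodd0.
have d1 : (expR u - 1) / u @[u --> (0:R)^'] --> (1 : R).
  have [] := is_derive_expR (0 : R); rewrite expR0 => d d0; rewrite -d0.
  apply: cvg_trans d; apply: near_eq_cvg; near=> u.
  by rewrite /= addr0 expR0 /GRing.scale/= mulr1 mulrC d0.
have l1 : ln ((expR u - 1) / u) @[u --> (0:R)^'] --> ln (1 : R).
  by apply: (cvg_comp _ _ d1); exact: continuous_ln.
have l2 := cvgN l1; rewrite ln1 oppr0 in l2.
have E : {near (0:R)^', (fun u : R => - ln ((expR u - 1) / u)) =1 logtodd}.
  near=> u; rewrite logtoddE//.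
  by near: u; exact: nbhs_dnbhs_neq.
by apply: (cvg_trans (near_eq_cvg E)); apply: l2.
Unshelve. all: by end_near. Qed.

End affine_change.

Section log_coordinates.
Variable R : realType.
Notation mu := (@lebesgue_measure R).
Implicit Types f : R -> R[i].

Definition logre f (x : R) : R := Re (f (expR x)).
Definition logim f (x : R) : R := Im (f (expR x)).

Lemma real_schwartz_continuous (g : R -> R) : real_schwartz g -> continuous g.
Proof.
move=> [dg _] x; apply: differentiable_continuous; apply/derivable1_diffP.
exact: (dg 0%N x).
Qed.

(** Boundedness of g and of x^2 g gives a bound by a multiple of the Cauchy
    density. *)
Lemma real_schwartz_integrable_bounded (g : R -> R) : real_schwartz g -> integrable_bounded g.
Proof.
move=> sg; have cg := real_schwartz_continuous sg; case: sg => _ bg.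
have [C0 C0P] := bg 0%N 0%N; have [C2 C2P] := bg 2 0%N.
have g0 x : `|g x| <= C0 by have := C0P x; rewrite expr0 mul1r.
split; last by exists C0.
have gle x : `|g x| <= (C0 + C2) * pi * cauchy_density x.
  have p1 : 0 < 1 + x ^+ 2 by rewrite ltr_wpDr// sqr_ge0.
  rewrite /cauchy_density invfM mulrA mulfK ?gt_eqF ?pi_gt0// ler_pdivlMr//.
  rewrite mulrDr mulr1 lerD//; have := C2P x; rewrite normrM ger0_norm ?sqr_ge0//.
  by rewrite mulrC.
have ic := integrable_scaler ((C0 + C2) * pi) (integrable_cauchy_density R).
apply: le_integrable ic => //.
  by apply/measurable_EFinP; exact: continuous_measurable_fun.
by move=> x _ /=; rewrite lee_fin; apply: le_trans (gle x) _; exact: ler_norm.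
Qed.

Lemma normc_sqr (z : R[i]) : normc z ^+ 2 = Re z ^+ 2 + Im z ^+ 2.
Proof. by case: z => x y /=; rewrite sqr_sqrtr// addr_ge0 ?sqr_ge0. Qed.

Lemma measurable_logre f : cmeasurable_fun (Rpos R) f -> measurable_fun setT (logre f).
Proof.
move=> [mf _]; apply: (@measurable_comp _ _ _ _ _ _ (Rpos R) (Re \o f) _ expR) => //.
- exact: measurable_Rpos.
- by move=> _ [x _ <-]; rewrite RposE expR_gt0.
Qed.

Lemma measurable_logim f : cmeasurable_fun (Rpos R) f -> measurable_fun setT (logim f).
Proof.
move=> [_ mf]; apply: (@measurable_comp _ _ _ _ _ _ (Rpos R) (Im \o f) _ expR) => //.
- exact: measurable_Rpos.
- by move=> _ [x _ <-]; rewrite RposE expR_gt0.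
Qed.

Lemma L2norm_sqr f : cmeasurable_fun (Rpos R) f ->
  (L2norm f `^ 2 = \int[mu]_x (logre f x ^+ 2 + logim f x ^+ 2)%:E)%E.
Proof.
move=> mf; rewrite /L2norm poweR_Lnorm ?pnatr_eq0//.
pose k x := (logre f x ^+ 2 + logim f x ^+ 2)%:E.
have mk : measurable_fun setT k.
  apply/measurable_EFinP; apply: measurable_funD; apply: measurable_funX.
    exact: measurable_logre.
  exact: measurable_logim.
rewrite -(ge0_integral_haar mk)//; last by move=> x; rewrite lee_fin addr_ge0 ?sqr_ge0.
rewrite [RHS]integral_mkcond; apply: eq_integral => r _.
rewrite /= !patchE; case: ifPn => [|_]; last first.
  by rewrite normr0 ?poweR_EFin powR_mulrn// expr0n.
rewrite inE RposE => r0; rewrite ?poweR_EFin powR_mulrn//.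
rewrite -normrX ger0_norm ?sqr_ge0//=.
by rewrite normc_sqr /k /logre /logim lnK.
Qed.

End log_coordinates.


(** * The affine Wigner distribution in logarithmic coordinates *)

Section strips.
Context d1 d2 (X : measurableType d1) (Y : measurableType d2) (R : realType).
Variables (m1 : {sigma_finite_measure set X -> \bar R})
          (m2 : {sigma_finite_measure set Y -> \bar R}).
Variable H : X * Y -> \bar R.
Hypotheses (mH : measurable_fun setT H) (H0 : forall z, (0 <= H z)%E).

Lemma integral_vertical_strip (A : set X) : measurable A ->
  (\int[m1 \x m2]_(z in A `*` setT) H z = \int[m1]_(x in A) \int[m2]_y H (x, y))%E.
Proof.
move=> mA; have mAT : measurable (A `*` [set: Y]) by exact: measurableX.
rewrite integral_mkcond [RHS]integral_mkcond.
have mHA : measurable_fun setT (H \_ (A `*` setT)).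
  by apply/(measurable_restrictT _ mAT); exact: measurable_funTS.
have HA0 z : (0 <= (H \_ (A `*` setT)) z)%E by apply: erestrict_ge0.
rewrite (fubini_tonelli1 _ mHA HA0); apply: eq_integral => x _.
rewrite /fubini_F !patchE; case: ifPn => xA.
  by apply: eq_integral => y _; rewrite patchE mem_set//; split => //; exact: set_mem.
apply: integral0_eq => y _; rewrite patchE memNset// => -[/= /mem_set].
by rewrite (negbTE xA).
Qed.

Lemma integral_horizontal_strip (B : set Y) : measurable B ->
  (\int[m1 \x m2]_(z in setT `*` B) H z = \int[m2]_(y in B) \int[m1]_x H (x, y))%E.
Proof.
move=> mB; have mTB : measurable ([set: X] `*` B) by exact: measurableX.
rewrite integral_mkcond [RHS]integral_mkcond.
have mHB : measurable_fun setT (H \_ (setT `*` B)).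
  by apply/(measurable_restrictT _ mTB); exact: measurable_funTS.
have HB0 z : (0 <= (H \_ (setT `*` B)) z)%E by apply: erestrict_ge0.
rewrite (fubini_tonelli2 _ mHB HB0); apply: eq_integral => y _.
rewrite /fubini_G !patchE; case: ifPn => yB.
  by apply: eq_integral => x _; rewrite patchE mem_set//; split => //; exact: set_mem.
apply: integral0_eq => x _; rewrite patchE memNset// => -[/= _ /mem_set].
by rewrite (negbTE yB).
Qed.

End strips.

Section wigner_log.
Variable R : realType.
Notation mu := (@lebesgue_measure R).
Variable f : R -> R[i].
Notation a := (logre f).
Notation b := (logim f).
Hypotheses (ha : integrable_bounded a) (hb : integrable_bounded b).

Let ma : measurable_fun setT a. Proof. exact: integrable_bounded_measurable. Qed.
Let mb : measurable_fun setT b. Proof. exact: integrable_bounded_measurable. Qed.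

(** Removes the origin, where the arguments of f in the affine Wigner
    distribution are quotients by 0. *)
Lemma eq_Rintegral_off0 (g h : R -> R) : measurable_fun setT h ->
  (forall u, u != 0 -> g u = h u) -> \int[mu]_u g u = \int[mu]_u h u.
Proof.
move=> mh gh; rewrite /Rintegral; congr fine.
have mD : measurable ([set: R] `\ (0 : R)) by exact: measurableD.
have mhD : measurable_fun ([set: R] `\ (0 : R)) (EFin \o h).
  by apply: measurable_funTS; exact/measurable_EFinP.
have ghD (u : R) : u \in ([set: R] `\ (0 : R)) -> (g u)%:E = (h u)%:E.
  by rewrite inE => -[_ /eqP /gh ->].
rewrite -(@integral_setD1 R (fun u => (g u)%:E) 0 setT) //; last first.
  apply: (eq_measurable_fun (EFin \o h)) => // u uD; by rewrite /= ghD.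
rewrite -(@integral_setD1 R (fun u => (h u)%:E) 0 setT) //.
exact: eq_integral.
Qed.

Let l := @logtodd R.
Let ml : measurable_fun setT l. Proof. exact: measurable_logtodd. Qed.

Definition wigner_im (w x : R) : R :=
  re_fourier (fun u => prod_im a b (x + l u + u) (x + l u)) (fun u => - prod_re a b (x + l u + u) (x + l u)) w.

Lemma measurable_wigner_im : measurable_fun setT (fun z : R * R => wigner_im z.1 z.2).
Proof.
have mlu : measurable_fun setT (fun z : (R * R) * R => z.1.2 + l z.2).
  apply: measurable_funD; first exact: measurableT_comp.
  exact: (measurableT_comp ml).
have mluu : measurable_fun setT (fun z : (R * R) * R => z.1.2 + l z.2 + z.2).
  exact: measurable_funD.
apply: (measurable_Rintegral_section mu (H := fun z : (R * R) * R =>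
  prod_im a b (z.1.2 + l z.2 + z.2) (z.1.2 + l z.2) * cos (2 * pi * z.1.1 * z.2) +
  - prod_re a b (z.1.2 + l z.2 + z.2) (z.1.2 + l z.2) * sin (2 * pi * z.1.1 * z.2))).
apply: measurable_re_fourier_integrand => //.
- exact: measurable_prod_im.
- apply: measurableT_comp => //; exact: measurable_prod_re.
- exact: measurableT_comp.
Qed.

Let arg1 x u : u != 0 -> expR x * u * expR u / (expR u - 1) = expR (x + l u + u).
Proof. by move=> u0; rewrite (expRD (x + l u)) (expRD x) expR_logtodd//; ring. Qed.

Let arg2 x u : u != 0 -> expR x * u / (expR u - 1) = expR (x + l u).
Proof. by move=> u0; rewrite (expRD x) expR_logtodd//; ring. Qed.

Let msection x : measurable_fun setT (fun u => x + l u).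
Proof. exact: measurable_funD. Qed.

Let msection2 x : measurable_fun setT (fun u => x + l u + u).
Proof. exact: measurable_funD. Qed.

Lemma Re_affine_Wigner w x : Re (affine_Wigner f w (expR x)) = wigner_re a b l w x.
Proof.
rewrite /affine_Wigner/=; apply: eq_Rintegral_off0.
  apply: measurable_re_fourier_integrand => //.
  - exact: measurable_prod_re.
  - exact: measurable_prod_im.
move=> u u0; rewrite arg1// arg2// /prod_re /prod_im /logre /logim.
case: (f (expR (x + l u + u))) => p q; case: (f (expR (x + l u))) => s t /=.
by rewrite cosN sinN; ring.
Qed.

Lemma Im_affine_Wigner w x : Im (affine_Wigner f w (expR x)) = wigner_im w x.
Proof.
rewrite /affine_Wigner/=; apply: eq_Rintegral_off0.
  apply: measurable_re_fourier_integrand => //.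
  - exact: measurable_prod_im.
  - apply: measurableT_comp => //; exact: measurable_prod_re.
move=> u u0; rewrite arg1// arg2// /prod_re /prod_im /logre /logim.
case: (f (expR (x + l u + u))) => p q; case: (f (expR (x + l u))) => s t /=.
by rewrite cosN sinN; ring.
Qed.

Definition wigner_norm (z : R * R) : R :=
  Num.sqrt (wigner_re a b l z.1 z.2 ^+ 2 + wigner_im z.1 z.2 ^+ 2).

Lemma normc_affine_Wigner w x : normc (affine_Wigner f w (expR x)) = wigner_norm (w, x).
Proof.
have normcE (z : R[i]) : normc z = Num.sqrt (Re z ^+ 2 + Im z ^+ 2) by case: z.
by rewrite normcE Re_affine_Wigner Im_affine_Wigner.
Qed.

Lemma measurable_wigner_norm : measurable_fun setT wigner_norm.
Proof.
have msqrt : measurable_fun [set: R] (@Num.sqrt R).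
  by apply: continuous_measurable_fun; exact: sqrt_continuous.
apply: (measurableT_comp msqrt); apply: measurable_funD; apply: measurable_funX.
  exact: measurable_wigner_re.
exact: measurable_wigner_im.
Qed.

Lemma wigner_re_le_norm w x : `|wigner_re a b l w x| <= wigner_norm (w, x).
Proof. by rewrite -sqrtr_sqr ler_wsqrtr//= lerDl sqr_ge0. Qed.

Definition high_freq (xi : R) : set R := ~` `[- xi, xi].

Definition log_outside (xi : R) : set R := ~` [set x : R | xi^-1 <= expR x <= xi].

Definition log_tail (xi : R) : set (R * R) :=
  ~` (`[- xi, xi] `*` [set x : R | xi^-1 <= expR x <= xi]).

Lemma measurable_log_box (xi : R) : measurable [set x : R | xi^-1 <= expR x <= xi].
Proof.
have -> : [set x : R | xi^-1 <= expR x <= xi] = expR @^-1` `[xi^-1, xi]%classic.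
  by apply/seteqP; split => x /=; rewrite in_itv.
rewrite -[X in measurable X]setTI; apply: measurable_expR => //; exact: measurable_itv.
Qed.

Lemma measurable_log_tail xi : measurable (log_tail xi).
Proof.
by apply: measurableC; apply: measurableX => //; exact: measurable_log_box.
Qed.

Definition map_log (p : R * R) : R * R := (p.1, ln p.2).

Lemma measurable_map_log : measurable_fun setT map_log.
Proof.
by apply: measurable_fun_pair => //; apply: (measurableT_comp (@measurable_ln R)).
Qed.

Lemma map_log_preserving : measure_preserving (mu \x @haar R)%E (mu \x mu)%E map_log.
Proof.
split; first exact: measurable_map_log.
move=> A mA.
pose phi : measurableTypeR R * measurableTypeR R -> measurableTypeR R * measurableTypeR R := map_log.
apply/esym; have H := @product_measure_unique _ _ _ _ _ mu mu
  (pushforward (mu \x @haar R)%E phi).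
refine (H measurable_map_log _ A mA) => {mA H}A B mA mB.
change ((mu \x @haar R)%E (map_log @^-1` (A `*` B)) = (mu A * mu B)%E).
have -> : map_log @^-1` (A `*` B) = A `*` (@ln R @^-1` B).
  by apply/seteqP; split => -[w r].
have [ml' pl] := haar_ln R.
rewrite -(pl B mB); apply: product_measure1E => //.
by rewrite -[X in measurable X]setTI; exact: ml'.
Qed.

(** The half-plane where the second coordinate is not positive is null for the
    product with the Haar measure. *)
Lemma tail_massE xi : (tail_mass f xi = \int[mu \x mu]_(z in log_tail xi) (wigner_norm z)%:E)%E.
Proof.
pose D := [set: R] `*` Rpos R.
have mD : measurable D by apply: measurableX => //; exact: measurable_Rpos.
have TE : tail_region xi = D `&` (map_log @^-1` (log_tail xi)).
  rewrite /tail_region -/D; apply/seteqP; split => -[w r] /= [Dr h]; split => //.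
    move=> [h1 h2]; apply: h; split => //=; rewrite in_itv/=.
    by move: h2; rewrite /map_log /= lnK//; case: Dr => _; rewrite /= RposE.
  move=> [h1 h2]; apply: h; split => //=.
  move: h2; rewrite /= in_itv/= lnK//; by case: Dr => _; rewrite /= RposE.
have mN : measurable_fun setT (fun z => (wigner_norm z)%:E).
  by apply/measurable_EFinP; exact: measurable_wigner_norm.
pose F := ((fun z => (wigner_norm z)%:E) \_ (log_tail xi))%E.
have mF : measurable_fun setT F.
  by apply/(measurable_restrictT _ (measurable_log_tail xi)); exact: measurable_funTS.
have F0 z : (0 <= F z)%E by apply: erestrict_ge0 => ? _; rewrite lee_fin sqrtr_ge0.
rewrite [RHS]integral_mkcond -/F -(ge0_integral_preserving map_log_preserving mF F0).
have mFl : measurable_fun setT (fun p => F (map_log p)) := measurableT_comp mF measurable_map_log.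
have mDC : measurable (~` D) by exact: measurableC.
have DC0 : (mu \x @haar R)%E (~` D) = 0%E.
  rewrite (_ : ~` D = setT `*` ~` Rpos R); last first.
    apply/seteqP; split => -[w r] /=; rewrite /D/=; first by move=> h; split => // hr; exact: h.
    by move=> [_ h] [_].
  have mC : measurable (~` Rpos R) by apply: measurableC; exact: measurable_Rpos.
  transitivity (mu setT * haar (~` Rpos R))%E; first exact: product_measure1E.
  by rewrite haar_RposC ?setICl// mule0.
rewrite [RHS](@ge0_negligible_integral _ _ _ (mu \x @haar R)%E setT (~` D) _ mDC measurableT mFl _ DC0)//.
rewrite setTD setCK /tail_mass TE integral_mkcondr; apply: eq_integral => -[w r].
rewrite inE => -[_ /=]; rewrite RposE => r0.
rewrite /F !patchE (_ : ((w, r) \in _) = (map_log (w, r) \in log_tail xi)); last first.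
  by apply/idP/idP; rewrite !inE.
have W : normc (affine_Wigner f w r) = wigner_norm (w, ln r).
  by rewrite -normc_affine_Wigner lnK.
by rewrite -[(wigner_norm (map_log (w, r)))%:E]/((wigner_norm (w, ln r))%:E) -W.
Qed.

Let maw : measurable_fun setT (fun z : R * R => `|wigner_re a b l z.1 z.2|%:E).
Proof. by apply/measurable_EFinP; apply: measurableT_comp => //; exact: measurable_wigner_re. Qed.

Lemma wigner_re_tail_le xi :
  (\int[mu \x mu]_(z in log_tail xi) `|wigner_re a b l z.1 z.2|%:E <= tail_mass f xi)%E.
Proof.
rewrite tail_massE; apply: ge0_le_integral => //.
- exact: measurable_log_tail.
- by apply: measurable_funTS; exact: maw.
- by apply: measurable_funTS; apply/measurable_EFinP; exact: measurable_wigner_norm.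
- by move=> [w x] _; rewrite lee_fin wigner_re_le_norm.
Qed.

(** The frequency marginal, integrated over the strip |w| > xi, which lies in
    the tail region. *)
Lemma power_spectrum_tail_le xi :
  (\int[mu]_(w in high_freq xi) (power_spectrum a b w)%:E <= tail_mass f xi)%E.
Proof.
apply: le_trans (wigner_re_tail_le xi).
have mA : measurable (high_freq xi) by apply: measurableC; exact: measurable_itv.
apply: (@le_trans _ _ (\int[mu]_(w in high_freq xi) \int[mu]_x `|wigner_re a b l w x|%:E)%E).
  apply: ge0_le_integral => //.
  - by move=> w _; rewrite lee_fin power_spectrum_ge0.
  - apply: measurable_funTS; apply/measurable_EFinP; apply: measurable_power_spectrum.
      by case: ha.
    by case: hb.
  - apply: measurable_funTS.
    exact: (measurable_fun_fubini_tonelli_F (m2 := mu) _ maw).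
  - move=> w _; have iw := integrable_wigner_re ha hb ml w.
    rewrite -(Rintegral_wigner_re ha hb ml).
    rewrite /Rintegral fineK; last by apply: integrable_fin_num => //.
    apply: le_trans (lee_abs _) _; apply: le_abse_integral => //.
    by case/integrableP : iw.
rewrite -(integral_vertical_strip mu mu maw)//.
apply: ge0_subset_integral => //.
- exact: measurableX.
- exact: measurable_log_tail.
- by apply: measurable_funTS; exact: maw.
- by move=> [w x] [/= h _] [].
Qed.

Hypotheses (ca : continuous a) (cb : continuous b).

(** The space marginal, integrated over the strip |x| > log xi, which lies in
    the tail region. *)
Lemma mass_tail_le xi :
  (\int[mu]_(x in log_outside xi) (a x ^+ 2 + b x ^+ 2)%:E <=
   tail_mass f xi)%E.
Proof.
apply: le_trans (wigner_re_tail_le xi).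
have mA : measurable (log_outside xi).
  by apply: measurableC; exact: measurable_log_box.
have aeH : {ae mu, forall x, log_outside xi x ->
    ((a x ^+ 2 + b x ^+ 2)%:E <= \int[mu]_w `|wigner_re a b l w x|%:E)%E}.
  have aeT := ae_le_integral_wigner_re ha hb ml ca cb (@logtodd0 R) (@continuous_logtodd0 R).
  exact: (@filterS _ _ (ae_filter_ringOfSetsType mu) _ _ (fun x h _ => h) aeT).
apply: (@le_trans _ _ (\int[mu]_(x in log_outside xi)
   \int[mu]_w `|wigner_re a b l w x|%:E)%E).
  apply: ae_ge0_le_integral => //.
  - by move=> x _; rewrite lee_fin addr_ge0 ?sqr_ge0.
  - apply: measurable_funTS; apply/measurable_EFinP; apply: measurable_funD;
      exact: measurable_funX.
  - by move=> x _; exact: integral_ge0.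
  - apply: measurable_funTS.
    exact: (measurable_fun_fubini_tonelli_G (m1 := mu) _ maw).
rewrite -(integral_horizontal_strip mu mu maw)//.
apply: ge0_subset_integral => //.
- exact: measurableX.
- exact: measurable_log_tail.
- by apply: measurable_funTS; exact: maw.
- by move=> [w x] [/= _ h] [].
Qed.

End wigner_log.


(** * Completeness and compactness in L2 *)

Section riesz_fischer.
Context d (T : measurableType d) (R : realType).
Variable m : {measure set T -> \bar R}.
Variable h : nat -> T -> R.
Hypothesis mh : forall n, measurable_fun setT (h n).
Hypothesis h_cauchy : forall n k, (n <= k)%N ->
  (\int[m]_x ((h n x - h k x) ^+ 2)%:E <= (16^-1 ^+ n)%:E)%E.

Lemma cvg_of_geometric_steps (u : R^nat) (B : R) :
  (forall n, `|u n.+1 - u n| <= B * 2^-1 ^+ n) -> cvgn u.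
Proof.
move=> uB.
have cs : cvgn (series (telescope u)).
  apply: normed_cvg; apply: (@series_le_cvg _ _ (geometric B 2^-1)).
  - by move=> n /=.
  - by move=> n; apply: le_trans (uB n).
  - exact: uB.
  - by apply: is_cvg_geometric_series; rewrite ger0_norm ?invr_ge0// invf_lt1// ltr1n.
rewrite (_ : u = (fun n => u 0%N + series (telescope u) n)).
  by apply: is_cvgD => //; exact: is_cvg_cst.
by apply/funext => n; exact: eq_sum_telescope.
Qed.

Let term n x : \bar R := (4 ^+ n * (h n x - h n.+1 x) ^+ 2)%:E.

Let mterm n : measurable_fun setT (term n).
Proof.
apply/measurable_EFinP; apply: measurable_funM => //; apply: measurable_funX.
exact: measurable_funB.
Qed.

Let term_ge0 n x : (0 <= term n x)%E.
Proof. by rewrite lee_fin; apply: mulr_ge0; [exact: exprn_ge0|exact: sqr_ge0]. Qed.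

Let sum_lty : (\int[m]_x (\sum_(n <oo) term n x) < +oo)%E.
Proof.
rewrite integral_nneseries//.
apply: (@le_lt_trans _ _ (\sum_(n <oo) (geometric 1 4^-1 n)%:E)%E).
  apply: lee_nneseries => n _. 
    by move=> _; apply: integral_ge0 => x _; exact: term_ge0.
  rewrite /term; under eq_integral do rewrite EFinM.
  have msq : measurable_fun setT (fun x => ((h n x - h n.+1 x) ^+ 2)%:E).
    by apply/measurable_EFinP; apply: measurable_funX; exact: measurable_funB.
  have sq0 x : setT x -> (0 <= ((h n x - h n.+1 x) ^+ 2)%:E)%E.
    by move=> _; rewrite lee_fin sqr_ge0.
  rewrite ge0_integralZl ?lee_fin ?exprn_ge0//.
  apply: (@le_trans _ _ ((4 ^+ n)%:E * (16^-1 ^+ n)%:E)%E).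
    by apply: lee_wpmul2l; [rewrite lee_fin exprn_ge0|exact: h_cauchy].
  rewrite -EFinM lee_fin -exprMn /= mul1r (_ : 4 * 16^-1 = 4^-1 :> R)//.
  by field.
have g1 : `|4^-1| < 1 :> R by rewrite ger0_norm ?invr_ge0// invf_lt1// ltr1n.
pose L : R := limn (series (geometric (1 : R) 4^-1)).
rewrite (_ : (\sum_(n <oo) _)%E = L%:E) ?ltry// /L.
rewrite -EFin_lim; last exact: is_cvg_geometric_series.
by congr (limn _); apply/funext => n /=; rewrite sumEFin.
Qed.

Let good x := cvgn (h ^~ x).

Let ae_good : {ae m, forall x, good x}.
Proof.
have s0 x : (0 <= \sum_(n <oo) term n x)%E.
  by apply: nneseries_ge0 => n _ _; exact: term_ge0.
have isum : m.-integrable setT (fun x => (\sum_(n <oo) term n x)%E).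
  apply/integrableP; split; first exact: ge0_emeasurable_sum.
  by under eq_integral => x _ do rewrite gee0_abs//; exact: sum_lty.
have := integrable_ae measurableT isum.
apply: (@filterS _ _ (ae_filter_ringOfSetsType m)) => x /(_ I) sx.
pose B := fine (\sum_(n <oo) term n x)%E.
have tB n : 4 ^+ n * (h n x - h n.+1 x) ^+ 2 <= B.
  rewrite -lee_fin fineK// -/(term n x).
  have := @nneseries_lim_ge _ (term ^~ x) xpredT 0 n.+1 (fun k _ _ => term_ge0 k x).
  apply: le_trans.
  by rewrite big_mkcond big_nat_recr//= leeDr// sume_ge0.
have B0 : 0 <= B by exact: fine_ge0.
apply: (@cvg_of_geometric_steps _ (Num.sqrt B)) => n.
rewrite distrC -ler_sqr ?nnegrE ?mulr_ge0 ?sqrtr_ge0 ?exprn_ge0//.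
rewrite exprMn sqr_sqrtr// real_normK ?num_real// -exprM mulnC exprM.
rewrite (_ : 2^-1 ^+ 2 = 4^-1 :> R); last by field.
by rewrite exprVn ler_pdivlMr ?exprn_gt0// mulrC.
Qed.

(** Weighting the squared steps by 4^n keeps their sum integrable, hence finite
    almost everywhere; where it is finite the steps are O(2^-n) and the sequence
    converges.  Fatou's lemma passes the bounds to the limit. *)
Lemma riesz_fischer : exists g : T -> R, measurable_fun setT g /\
  forall n, (\int[m]_x ((h n x - g x) ^+ 2)%:E <= (16^-1 ^+ n)%:E)%E.
Proof.
(* a measurable representative of the limit: the upper limit, 0 if infinite *)
pose g x := fine (limn_esup (fun n => (h n x)%:E)).
have mg : measurable_fun setT g.
  apply: measurableT_comp => //; apply: measurable_fun_limn_esup => n.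
  by apply/measurable_EFinP.
have hg x : good x -> h n x @[n --> \oo] --> g x.
  move=> gx; have c : (h n x)%:E @[n --> \oo] --> (limn (h ^~ x))%:E.
    by apply: cvg_EFin; [near=> n|exact: gx].
  rewrite /g is_cvg_limn_esupE; last by apply/cvg_ex; eexists; exact: c.
  by rewrite (cvg_lim _ c).
exists g; split => // n.
have [N [mN N0 gN]] := ae_good.
have mD : measurable (~` N) by exact: measurableC.
have mhg : measurable_fun setT (fun x => ((h n x - g x) ^+ 2)%:E).
  by apply/measurable_EFinP; apply: measurable_funX; exact: measurable_funB.
have mhh k : measurable_fun setT (fun x => ((h n x - h k x) ^+ 2)%:E).
  by apply/measurable_EFinP; apply: measurable_funX; exact: measurable_funB.
rewrite (@ge0_negligible_integral _ _ _ m setT N _ mN measurableT mhg _ N0); last first.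
  by move=> x _; rewrite lee_fin sqr_ge0.
rewrite setTD.
rewrite (eq_integral (fun x => limn_einf (fun k => ((h n x - h k x) ^+ 2)%:E))); last first.
  move=> x; rewrite inE => xN; have gx : good x by apply: contrapT => /gN.
  have c : ((h n x - h k x) ^+ 2)%:E @[k --> \oo] --> ((h n x - g x) ^+ 2)%:E.
    apply: cvg_EFin; first by near=> k.
    have c1 : (h n x - h k x) @[k --> \oo] --> h n x - g x.
      by apply: cvgB; [exact: cvg_cst|exact: hg].
    by rewrite expr2; under eq_fun do rewrite expr2; exact: cvgM.
  rewrite is_cvg_limn_einfE; last by apply/cvg_ex; eexists; exact: c.
  by apply/esym/cvg_lim.
apply: le_trans (fatou _ _ _ _) _ => //.
- by move=> k; apply: measurable_funTS; exact: mhh.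
- by move=> k x _; rewrite lee_fin sqr_ge0.
rewrite limn_einf_lim; apply: lime_le; first exact: is_cvg_einfs.
near=> k; have nk : (n <= k)%N by near: k; exact: nbhs_infty_ge.
apply: le_trans (ereal_inf_lbound _) _.
  by exists k => //=; exact: leqnn.
apply: le_trans (h_cauchy nk).
apply: ge0_subset_integral => //.
by move=> x _; rewrite lee_fin sqr_ge0.
Unshelve. all: by end_near. Qed.

End riesz_fischer.

Section L2_topology.
Variable R : realType.
Notation mu := (@lebesgue_measure R).
Implicit Types f g : L2 R.

Definition dist2 f g : \bar R :=
  (\int[mu]_x ((logre f x - logre g x) ^+ 2 + (logim f x - logim g x) ^+ 2)%:E)%E.

Lemma L2norm_ltE (f : R -> R[i]) e : 0 < e -> cmeasurable_fun (Rpos R) f ->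
  (L2norm f < e%:E)%E =
  (\int[mu]_x (logre f x ^+ 2 + logim f x ^+ 2)%:E < (e ^+ 2)%:E)%E.
Proof.
move=> e0 mf; rewrite -L2norm_sqr//.
have : (0 <= L2norm f)%E by exact: Lnorm_ge0.
case: (L2norm f) => [r|_|//]; last by rewrite poweRyr// !ltNge !leey.
rewrite lee_fin => r0; rewrite poweR_EFin powR_mulrn// !lte_fin.
by rewrite ltr_pXn2r// nnegrE// ltW.
Qed.

Lemma L2_ballE f g e : 0 < e -> L2_ball f e g = (dist2 f g < (e ^+ 2)%:E)%E :> Prop.
Proof.
move=> e0; rewrite /L2_ball/= L2norm_ltE//.
  congr (is_true (_ < _)%E); apply: eq_integral => x _; congr EFin.
  by rewrite /logre /logim /=; case: (f _) (g _) => [p q] [s t].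
by apply: cmeasurable_funB; [exact: measurable_Rpos|exact: L2_measurable|exact: L2_measurable].
Qed.

Lemma L2_ball_le f e1 e2 : e1 <= e2 -> L2_ball f e1 `<=` L2_ball f e2.
Proof. by move=> e12 g; rewrite /L2_ball/= => /lt_le_trans; apply; rewrite lee_fin. Qed.

Lemma L2_of_log (a b : R -> R) : measurable_fun setT a -> measurable_fun setT b ->
  (\int[mu]_x (a x ^+ 2 + b x ^+ 2)%:E < +oo)%E ->
  exists f : L2 R, logre f = a /\ logim f = b.
Proof.
move=> ma mb ab; pose F (r : R) : R[i] := Complex (a (ln r)) (b (ln r)).
have mF : cmeasurable_fun (Rpos R) F.
  split; apply: measurable_funTS.
    exact: (measurableT_comp ma (@measurable_ln R)).
  exact: (measurableT_comp mb (@measurable_ln R)).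
have aE : logre F = a by apply/funext => x; rewrite /logre/= expRK.
have bE : logim F = b by apply/funext => x; rewrite /logim/= expRK.
have FE := L2norm_sqr mF; rewrite aE bE in FE.
have fF : (L2norm F < +oo)%E.
  move: ab; rewrite -FE; case: (L2norm F) => [r _|//|//]; first exact: ltry.
  by rewrite poweRyr.
by exists (MkL2 mF fF).
Qed.

Lemma L2_complete (f : nat -> L2 R) :
  (forall n k, (n <= k)%N -> L2_ball (f n) (4^-1 ^+ n) (f k)) ->
  exists p : L2 R, forall n, L2_ball (f n) (2 * 4^-1 ^+ n) p.
Proof.
move=> fc.
have e0 n : 0 < 4^-1 ^+ n :> R by rewrite exprn_gt0// invr_gt0.
have e2 n : (4^-1 ^+ n) ^+ 2 = 16^-1 ^+ n :> R.
  by rewrite -exprM mulnC exprM; congr (_ ^+ n); field.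
have ma n := measurable_logre (L2_measurable (f n)).
have mb n := measurable_logim (L2_measurable (f n)).
have dle n k : (n <= k)%N -> (dist2 (f n) (f k) <= (16^-1 ^+ n)%:E)%E.
  by move=> nk; have := fc _ _ nk; rewrite L2_ballE// e2 => /ltW.
have md n k : measurable_fun setT (fun x => ((logre (f n) x - logre (f k) x) ^+ 2 +
    (logim (f n) x - logim (f k) x) ^+ 2)%:E).
  by apply/measurable_EFinP; apply: measurable_funD; apply: measurable_funX; exact: measurable_funB.
have mre n k : measurable_fun setT (fun x => ((logre (f n) x - logre (f k) x) ^+ 2)%:E).
  by apply/measurable_EFinP; apply: measurable_funX; exact: measurable_funB.
have mim n k : measurable_fun setT (fun x => ((logim (f n) x - logim (f k) x) ^+ 2)%:E).
  by apply/measurable_EFinP; apply: measurable_funX; exact: measurable_funB.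
(* real and imaginary parts converge separately, which costs the factor 2 *)
have [a [ma' ha]] : exists g : R -> R, measurable_fun setT g /\
    forall n, (\int[mu]_x ((logre (f n) x - g x) ^+ 2)%:E <= (16^-1 ^+ n)%:E)%E.
  apply: (@riesz_fischer _ (measurableTypeR R) R mu (fun n => logre (f n))) => // n k nk; apply: le_trans (dle _ _ nk).
  apply: ge0_le_integral; [exact: measurableT| |exact: mre|exact: md|].
    by move=> x _; rewrite lee_fin sqr_ge0.
  by move=> x _; rewrite lee_fin lerDl sqr_ge0.
have [b [mb' hb]] : exists g : R -> R, measurable_fun setT g /\
    forall n, (\int[mu]_x ((logim (f n) x - g x) ^+ 2)%:E <= (16^-1 ^+ n)%:E)%E.
  apply: (@riesz_fischer _ (measurableTypeR R) R mu (fun n => logim (f n))) => // n k nk; apply: le_trans (dle _ _ nk).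
  apply: ge0_le_integral; [exact: measurableT| |exact: mim|exact: md|].
    by move=> x _; rewrite lee_fin sqr_ge0.
  by move=> x _; rewrite lee_fin lerDr sqr_ge0.
have mab n : measurable_fun setT (fun x => ((logre (f n) x - a x) ^+ 2)%:E).
  by apply/measurable_EFinP; apply: measurable_funX; exact: measurable_funB.
have mbb n : measurable_fun setT (fun x => ((logim (f n) x - b x) ^+ 2)%:E).
  by apply/measurable_EFinP; apply: measurable_funX; exact: measurable_funB.
have dI n : (\int[mu]_x ((logre (f n) x - a x) ^+ 2 + (logim (f n) x - b x) ^+ 2)%:E <=
    (16^-1 ^+ n + 16^-1 ^+ n)%:E)%E.
  under eq_integral do rewrite EFinD.
  have a0 x : setT x -> (0 <= ((logre (f n) x - a x) ^+ 2)%:E)%E.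
    by move=> _; rewrite lee_fin sqr_ge0.
  have b0 x : setT x -> (0 <= ((logim (f n) x - b x) ^+ 2)%:E)%E.
    by move=> _; rewrite lee_fin sqr_ge0.
  rewrite (ge0_integralD mu measurableT a0 (mab n) b0 (mbb n)) EFinD.
  exact: leeD.
have [p [pa pb]] : exists p : L2 R, logre p = a /\ logim p = b.
  apply: L2_of_log => //.
  have f0 : (\int[mu]_x (logre (f 0%N) x ^+ 2 + logim (f 0%N) x ^+ 2)%:E < +oo)%E.
    rewrite -L2norm_sqr; last exact: L2_measurable.
    have : (0 <= L2norm (f 0%N))%E by exact: Lnorm_ge0.
    have := L2_finite (f 0%N); case: (L2norm _) => [r _ _|//|//].
    by rewrite poweR_EFin ltry.
  have mf0 : measurable_fun setT (fun x => (logre (f 0%N) x ^+ 2 + logim (f 0%N) x ^+ 2)%:E).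
    by apply/measurable_EFinP; apply: measurable_funD; exact: measurable_funX.
  have md0 : measurable_fun setT (fun x =>
     ((logre (f 0%N) x - a x) ^+ 2 + (logim (f 0%N) x - b x) ^+ 2)%:E).
    by apply/measurable_EFinP; apply: measurable_funD; apply: measurable_funX; exact: measurable_funB.
  apply: (@le_lt_trans _ _ (\int[mu]_x (2%:E * (logre (f 0%N) x ^+ 2 + logim (f 0%N) x ^+ 2)%:E +
    2%:E * ((logre (f 0%N) x - a x) ^+ 2 + (logim (f 0%N) x - b x) ^+ 2)%:E))%E).
    apply: ge0_le_integral; [exact: measurableT| | | |].
    - by move=> x _; rewrite lee_fin addr_ge0 ?sqr_ge0.
    - by apply/measurable_EFinP; apply: measurable_funD; exact: measurable_funX.
    - by apply: emeasurable_funD; exact: measurable_funeM.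
    - move=> x _; rewrite -!EFinM -EFinD lee_fin.
      set u := logre _ _; set v := logim _ _.
      have := sqr_ge0 (2 * u - a x); have := sqr_ge0 (2 * v - b x).
      by rewrite !expr2 => *; lra.
  have p0 x : setT x -> (0 <= (logre (f 0%N) x ^+ 2 + logim (f 0%N) x ^+ 2)%:E)%E.
    by move=> _; rewrite lee_fin addr_ge0 ?sqr_ge0.
  have q0 x : setT x -> (0 <= ((logre (f 0%N) x - a x) ^+ 2 + (logim (f 0%N) x - b x) ^+ 2)%:E)%E.
    by move=> _; rewrite lee_fin addr_ge0 ?sqr_ge0.
  have two0 : (0 <= 2%:E :> \bar R)%E by rewrite lee_fin.
  rewrite (ge0_integralD mu measurableT (fun x _ => mule_ge0 two0 (p0 x I)) (measurable_funeM _ mf0)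
    (fun x _ => mule_ge0 two0 (q0 x I)) (measurable_funeM _ md0)).
  rewrite !ge0_integralZl//.
  apply: lte_add_pinfty; rewrite lte_mul_pinfty//.
  exact: le_lt_trans (dI 0%N) (ltry _).
exists p => n; rewrite L2_ballE ?mulr_gt0// /dist2 pa pb.
apply: le_lt_trans (dI n) _; rewrite lte_fin exprMn e2.
by have := e0 n; have : 0 < 16^-1 ^+ n :> R by [rewrite exprn_gt0// invr_gt0|]; lra.
Qed.

(** Finite covers of K by balls of radius e / 2 give finite covers of its closure
    by balls of radius e.  So an ultrafilter on the closure contains balls of
    every radius, and their centres form a Cauchy sequence. *)
Lemma totally_bounded_precompact (K : set (L2 R)) :
  (forall e : R, 0 < e -> exists (T : finType) (c : T -> L2 R),
     forall f, K f -> exists t, L2_ball (c t) e f) ->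
  precompact K.
Proof.
move=> tb; rewrite precompactE compact_ultra => F FU FK.
have FF : ProperFilter F by exact: ultra_proper.
have small (e : R) : 0 < e -> exists f, F (L2_ball f e).
  move=> e0; have e20 : 0 < e / 2 by rewrite divr_gt0.
  have [T [c cP]] := tb _ e20.
  apply: contrapT => /forallNP nF.
  have nt (t : T) : F (~` L2_ball (c t) e).
    by have [/(nF (c t))|] := in_ultra_setVsetC (L2_ball (c t) e) FU.
  have : F (closure K `&` [set f | forall t, ~ L2_ball (c t) e f]).
    by apply: filterI => //; apply: filter_forall => t; exact: nt.
  move=> /filter_ex [f [Kf nf]].
  have [g [Kg fg]] : K `&` L2_ball f (e / 2) !=set0.
    apply: Kf; exact: (nbhsx_ballx f _ e20).
  have [t tg] := cP _ Kg; apply: (nf t).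
  by rewrite (splitr e); apply: L2_ball_triangle tg _; exact: L2_ball_sym.
(* the halves make the distance of the n-th centre to all later ones < 4^-n *)
have e0 n : 0 < 4^-1 ^+ n / 2 :> R by rewrite divr_gt0// exprn_gt0// invr_gt0.
have /choice[f fP] : forall n, exists f, F (L2_ball f (4^-1 ^+ n / 2)).
  by move=> n; exact: small.
have fc n k : (n <= k)%N -> L2_ball (f n) (4^-1 ^+ n) (f k).
  move=> nk; have [g [gn gk]] := @filter_ex _ F _ _ (filterI (fP n) (fP k)).
  rewrite [X in L2_ball _ X]splitr; apply: L2_ball_triangle gn _.
  apply: L2_ball_sym; apply: L2_ball_le gk.
  rewrite ler_pM2r ?invr_gt0//; apply: ler_wiXn2l => //.
  by rewrite invf_le1// ler1n.
have [p pP] := L2_complete fc.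
have Fp : F --> p.
  move=> A /nbhs_ballP[e /= ee pA].
  have [n nE] : exists n, 4^-1 ^+ n / 2 + 2 * 4^-1 ^+ n <= e.
    have c : 4^-1 ^+ n @[n --> \oo] --> (0 : R).
      by apply: cvg_expr; rewrite ger0_norm ?invr_ge0// invf_lt1// ltr1n.
    have e3 : 0 < e / 3 by rewrite divr_gt0.
    have /cvgrPdist_le/(_ _ e3) [n _ /(_ n (leqnn n))] := c.
    rewrite sub0r normrN ger0_norm ?exprn_ge0 ?invr_ge0// => h.
    by exists n; lra.
  apply: filterS (fP n) => g gn; apply: pA; apply: L2_ball_le nE _ _.
  by rewrite addrC; apply: L2_ball_triangle (L2_ball_sym (pP n)) gn.
exists p; split => //.
by apply: (@closed_cvg _ _ F _ id (closure K)) => //; exact: closed_closure.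
Qed.

End L2_topology.

(** * Finite codes for equi-Lipschitz families *)

Section finite_codes.
Variable R : realType.

Lemma truncn_eq_close (x y : R) : 0 <= x -> 0 <= y ->
  Num.truncn x = Num.truncn y -> `|x - y| <= 1.
Proof.
move=> x0 y0 xy.
have /andP[h1 h2] := truncn_itv x0; have /andP[h3 h4] := truncn_itv y0.
move: h1 h2; rewrite xy -natr1 => h1 h2; move: h4; rewrite -natr1 => h4.
by rewrite ler_norml; apply/andP; split; lra.
Qed.

(** Quantize the values on a grid of [-xi, xi]: two functions with the same
    quantized values are close on the grid, hence everywhere by the Lipschitz
    bound. *)
Lemma equilipschitz_code (I : Type) (K : set I) (phi : I -> R -> R) (xi C eta : R) :
  0 < xi -> 0 < C -> 0 < eta ->
  (forall i w, K i -> `|phi i w| <= C) ->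
  (forall i w w', K i -> `|phi i w - phi i w'| <= C * `|w - w'|) ->
  exists (T : finType) (code : I -> T), forall i j, K i -> K j -> code i = code j ->
    forall w, - xi <= w <= xi -> `|phi i w - phi j w| <= eta.
Proof.
move=> xi0 C0 eta0 phiC phiL.
pose s := eta / 3; have s0 : 0 < s by rewrite divr_gt0.
pose h := s / C; have h0 : 0 < h by rewrite divr_gt0.
pose N := Num.truncn (2 * xi / h); pose m := Num.truncn (2 * C / s).
pose pt (k : nat) : R := - xi + h * k%:R.
pose val i w := Num.truncn ((phi i w + C) / s).
have phi0 i w : K i -> 0 <= (phi i w + C) / s.
  move=> Ki; have := phiC i w Ki; rewrite ler_norml => /andP[h1 h2].
  by apply: divr_ge0; [lra|exact: ltW].
have valm i w : K i -> (val i w <= m)%N.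
  move=> Ki; apply: le_truncn; rewrite ler_pM2r ?invr_gt0//.
  by have := phiC i w Ki; rewrite ler_norml => /andP[h1 h2]; lra.
(* consecutive grid points are h apart, and C * h = s = eta / 3 *)
exists {ffun 'I_N.+1 -> 'I_m.+1}, (fun i => [ffun k : 'I_N.+1 => inord (val i (pt k))]).
move=> i j Ki Kj /ffunP ij w /andP[w1 w2].
pose k := Num.truncn ((w + xi) / h).
have kh0 : 0 <= (w + xi) / h by apply: divr_ge0; [lra|exact: ltW].
have kN : (k < N.+1)%N.
  rewrite ltnS; apply: le_truncn; rewrite ler_pM2r ?invr_gt0//.
  by rewrite mulr_natl mulr2n lerD2r.
have := ij (Ordinal kN); rewrite !ffunE/= => /(congr1 (@nat_of_ord _)).
rewrite !inordK ?ltnS ?valm// => vE.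
have := truncn_eq_close (phi0 i (pt k) Ki) (phi0 j (pt k) Kj) vE.
have si : 0 <= s^-1 by rewrite invr_ge0 ltW.
rewrite -mulrBl normrM (ger0_norm si) ler_pdivrMr// mul1r.
rewrite opprD addrACA subrr addr0 => close.
have wk : `|w - pt k| <= h.
  have /andP[] := truncn_itv kh0; rewrite -/k ler_pdivlMr// ltr_pdivrMr// -natr1 => k1 k2.
  by rewrite /pt ler_norml; apply/andP; split; lra.
have Ch : C * h = s by rewrite /h mulrC divfK ?gt_eqF.
have li := le_trans (phiL i w (pt k) Ki) (ler_wpM2l (ltW C0) wk).
have lj := le_trans (phiL j w (pt k) Kj) (ler_wpM2l (ltW C0) wk).
rewrite Ch in li lj.
rewrite (_ : _ - _ = (phi i w - phi i (pt k)) + (phi i (pt k) - phi j (pt k)) -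
  (phi j w - phi j (pt k))); last by ring.
apply: le_trans (ler_normB _ _) _.
apply: le_trans (lerD (ler_normD _ _) lj) _.
by apply: le_trans (lerD (lerD li close) (lexx s)) _; rewrite /s; lra.
Qed.

Lemma sin_lipschitz (x y : R) : `|sin x - sin y| <= `|x - y|.
Proof.
wlog xy : x y / y <= x.
  by move=> H; have [/H//|/ltW/H] := leP y x; rewrite distrC (distrC y).
have [c _ ->] := @MVT_segment R (@sin R) (@cos R) _ _ xy
  (fun x _ => @is_derive_sin R x) (continuous_subspaceT (@continuous_sin R)).
by rewrite normrM -[leRHS]mul1r; apply: ler_wpM2r => //; exact: cos_max.
Qed.

Lemma cos_lipschitz (x y : R) : `|cos x - cos y| <= `|x - y|.
Proof.
wlog xy : x y / y <= x.
  by move=> H; have [/H//|/ltW/H] := leP y x; rewrite distrC (distrC y).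
have [c _ ->] := @MVT_segment R (@cos R) (fun x => - sin x) _ _ xy
  (fun x _ => @is_derive_cos R x) (continuous_subspaceT (@continuous_cos R)).
by rewrite normrM normrN -[leRHS]mul1r; apply: ler_wpM2r => //; exact: sin_max.
Qed.

End finite_codes.

Section localized_transform.
Variable R : realType.
Notation mu := (@lebesgue_measure R).

(** The phases 2 pi w x and 2 pi w' x differ by at most 2 pi L |w - w'| on the
    support. *)
Lemma re_fourier_lipschitz (p q : R -> R) (L w w' : R) : 0 <= L ->
  mu.-integrable setT (EFin \o p) -> mu.-integrable setT (EFin \o q) ->
  (forall x, L < `|x| -> p x = 0 /\ q x = 0) ->
  `|re_fourier p q w - re_fourier p q w'| <=
    (2 * pi * L) * (\int[mu]_x (`|p x| + `|q x|)) * `|w - w'|.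
Proof.
move=> L0 ip iq supp.
have i1 := integrable_re_fourier_integrand ip iq w; have i2 := integrable_re_fourier_integrand ip iq w'.
have ipq : mu.-integrable setT (EFin \o (fun x => `|p x| + `|q x|)).
  by apply: integrable_addr; exact: integrable_norm.
rewrite /re_fourier -RintegralB//.
have i12 : mu.-integrable setT (EFin \o (fun x =>
    (p x * cos (2 * pi * w * x) + q x * sin (2 * pi * w * x)) -
    (p x * cos (2 * pi * w' * x) + q x * sin (2 * pi * w' * x)))).
  exact: (integrableB measurableT i1 i2).
apply: le_trans (le_normr_Rintegral measurableT i12) _.
rewrite [leRHS]mulrAC -RintegralZl//.
apply: le_Rintegral => //.
- exact: (integrable_norm i12).
- exact: integrable_scaler.
move=> x _.
have [xL|/supp[-> ->]] := leP `|x| L; last first.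
  by rewrite !mul0r !addr0 subrr !normr0 addr0 mulr0.
have D : `|2 * pi * w * x - 2 * pi * w' * x| <= 2 * pi * L * `|w - w'|.
  rewrite -mulrBl -mulrBr !normrM (ger0_norm (pi_ge0 R)) [`|2|]ger0_norm//.
  rewrite [leRHS]mulrAC; apply: ler_wpM2l => //.
  by rewrite !mulr_ge0// pi_ge0.
rewrite (_ : _ - _ = p x * (cos (2 * pi * w * x) - cos (2 * pi * w' * x)) +
   q x * (sin (2 * pi * w * x) - sin (2 * pi * w' * x))); last by ring.
apply: le_trans (ler_normD _ _) _; rewrite !normrM [leRHS]mulrDr.
apply: lerD; rewrite mulrC; apply: ler_wpM2r => //.
  exact: le_trans (cos_lipschitz _ _) D.
exact: le_trans (sin_lipschitz _ _) D.
Qed.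

Lemma normr_le_half_sqr (t : R) : `|t| <= 2^-1 * (1 + t ^+ 2).
Proof.
have h := sqr_ge0 (`|t| - 1); have e := real_normK (num_real t).
by rewrite !expr2 in h e *; lra.
Qed.

(** On B one has |a| + |b| <= 1 + a^2 + b^2: the mass of a truncation is bounded
    by the length of B and the energy. *)
Lemma Rintegral_norm_localized (a b : R -> R) (B : set R) (M : R) :
  measurable B -> mu.-integrable setT (EFin \o (\1_B : R -> R)) ->
  integrable_bounded a -> integrable_bounded b -> energy a b <= M ->
  \int[mu]_x (`|a x * \1_B x| + `|b x * \1_B x|) <= \int[mu]_x \1_B x + M.
Proof.
move=> mB iB ha hb eM.
apply: (@le_trans _ _ (\int[mu]_x (\1_B x + (a x ^+ 2 + b x ^+ 2)))); last first.
  rewrite RintegralD//; last exact: integrable_energy.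
  exact: lerD.
have m1 : measurable_fun setT (\1_B : R -> R) by exact: measurable_indic.
have B1 x : `|\1_B x| <= 1 :> R.
  by rewrite indicE; case: (x \in B); rewrite ?normr1// normr0.
have [ia _] := integrable_boundedM1 ha m1 B1; have [ib _] := integrable_boundedM1 hb m1 B1.
apply: le_Rintegral => //.
- by apply: integrable_addr; exact: integrable_norm.
- by apply: integrable_addr => //; exact: integrable_energy.
move=> x _; rewrite indicE; case: (x \in B); rewrite ?mulr1 ?mulr0 ?normr0 ?add0r.
  have ea := normr_le_half_sqr (a x); have eb := normr_le_half_sqr (b x).
  have := sqr_ge0 (a x); have := sqr_ge0 (b x); rewrite mulr1n; lra.
by rewrite addr_ge0 ?sqr_ge0.
Qed.

End localized_transform.

(** * Functions concentrated in space and frequency *)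

Section splitting.
Variable R : realType.
Notation mu := (@lebesgue_measure R).

Definition regular (h : R -> R) := integrable_bounded h /\ continuous h.

Lemma regularB (g h : R -> R) : regular g -> regular h -> regular (fun x => g x - h x).
Proof.
move=> [ig cg] [ih ch]; split; first exact: integrable_boundedB.
by move=> x; apply: cvgB; [exact: cg|exact: ch].
Qed.

Lemma bessel (a b : R -> R) : integrable_bounded a -> integrable_bounded b ->
  (\int[mu]_w (power_spectrum a b w)%:E <= (energy a b)%:E)%E.
Proof. by move=> ha hb; exact: (integral_power_spectrum_le ha hb (l := cst 0)). Qed.

Lemma plancherel_le (a b : R -> R) : regular a -> regular b ->
  ((energy a b)%:E <= \int[mu]_w (power_spectrum a b w)%:E)%E.
Proof.
by move=> [ha ca] [hb cb]; exact: (energy_le_integral_power_spectrum ha hb (l := cst 0)).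
Qed.

Lemma energyE (a b : R -> R) : integrable_bounded a -> integrable_bounded b ->
  (\int[mu]_x (a x ^+ 2 + b x ^+ 2)%:E = (energy a b)%:E)%E.
Proof.
move=> ha hb; rewrite /energy /Rintegral fineK//.
by apply: integrable_fin_num => //; exact: integrable_energy.
Qed.

Lemma ge0_integral_setC (A : set R) (f : R -> \bar R) : measurable A ->
  measurable_fun setT f -> (forall x, 0 <= f x)%E ->
  (\int[mu]_x f x = \int[mu]_(x in A) f x + \int[mu]_(x in ~` A) f x)%E.
Proof.
move=> mA mf f0; rewrite -[in LHS](setUv A) ge0_integral_setU//.
- exact: measurableC.
- by rewrite setUv.
- by apply/disj_setPCl.
Qed.

Lemma integral_lincomb_le (A : set R) (f g1 g2 : R -> R) (c1 c2 : R) : measurable A ->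
  measurable_fun setT f -> measurable_fun setT g1 -> measurable_fun setT g2 ->
  (forall x, 0 <= f x) -> (forall x, 0 <= g1 x) -> (forall x, 0 <= g2 x) ->
  (forall x, f x <= 2 * g1 x + 2 * g2 x) ->
  (\int[mu]_(x in A) (g1 x)%:E <= c1%:E)%E ->
  (\int[mu]_(x in A) (g2 x)%:E <= c2%:E)%E ->
  (\int[mu]_(x in A) (f x)%:E <= (2 * c1 + 2 * c2)%:E)%E.
Proof.
move=> mA mf mg1 mg2 f0 g10 g20 fg g1c g2c.
have two0 : (0 <= 2%:E :> \bar R)%E by rewrite lee_fin.
have emf : measurable_fun A (EFin \o f) by apply: measurable_funTS; exact/measurable_EFinP.
have em1 : measurable_fun A (EFin \o g1) by apply: measurable_funTS; exact/measurable_EFinP.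
have em2 : measurable_fun A (EFin \o g2) by apply: measurable_funTS; exact/measurable_EFinP.
have e10 x : A x -> (0 <= (EFin \o g1) x)%E by rewrite lee_fin.
have e20 x : A x -> (0 <= (EFin \o g2) x)%E by rewrite lee_fin.
apply: (@le_trans _ _ (\int[mu]_(x in A) (2%:E * (EFin \o g1) x + 2%:E * (EFin \o g2) x))%E).
  apply: ge0_le_integral; [exact: mA| |exact: emf| |].
  - by move=> x _; rewrite lee_fin.
  - by apply: emeasurable_funD; exact: measurable_funeM.
  - by move=> x _; rewrite /= -!EFinM -EFinD lee_fin.
rewrite (ge0_integralD mu mA (fun x Ax => mule_ge0 two0 (e10 x Ax)) (measurable_funeM _ em1)
  (fun x Ax => mule_ge0 two0 (e20 x Ax)) (measurable_funeM _ em2)).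
have -> : (2 * c1 + 2 * c2)%:E = (2%:E * c1%:E + 2%:E * c2%:E)%E by [].
rewrite (ge0_integralZl mu mA em1 e10 two0) (ge0_integralZl mu mA em2 e20 two0).
by apply: leeD; apply: lee_wpmul2l.
Qed.

Variables (xi delta : R).
Hypotheses (xi1 : 1 < xi).

Let B : set R := [set x : R | xi^-1 <= expR x <= xi].
Let chi : R -> R := \1_B.

Let xi0 : 0 < xi. Proof. exact: lt_trans xi1. Qed.

Lemma log_boxE : B = `[- ln xi, ln xi]%classic.
Proof.
apply/seteqP; split => x; rewrite /B /= in_itv/=.
  by rewrite -[x in _ -> - _ <= x <= _]expRK -lnV ?posrE// !ler_ln ?posrE ?expR_gt0 ?invr_gt0.
by rewrite -[in X in X -> _](expRK x) -lnV ?posrE// !ler_ln ?posrE ?expR_gt0 ?invr_gt0.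
Qed.

Let mB : measurable B. Proof. exact: measurable_log_box. Qed.

Let mchi : measurable_fun setT chi. Proof. exact: measurable_indic. Qed.

Let chi1 x : `|chi x| <= 1.
Proof. by rewrite /chi indicE; case: (x \in B); rewrite ?normr1// normr0. Qed.

Lemma integrable_chi : mu.-integrable setT (EFin \o chi).
Proof. by rewrite /chi log_boxE; exact: integrable_indic_itv. Qed.

Record concentrated (a b : R -> R) := Concentrated {
  concentrated_re : regular a;
  concentrated_im : regular b;
  concentrated_freq : (\int[mu]_(w in high_freq xi) (power_spectrum a b w)%:E <= delta%:E)%E;
  concentrated_space :
    (\int[mu]_(x in log_outside xi) (a x ^+ 2 + b x ^+ 2)%:E <= delta%:E)%E
}.

Definition loc_re (a b : R -> R) w := re_fourier (fun x => a x * chi x) (fun x => b x * chi x) w.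
Definition loc_im (a b : R -> R) w := re_fourier (fun x => b x * chi x) (fun x => - (a x * chi x)) w.

Variables (a1 b1 a2 b2 : R -> R) (eta : R).
Hypotheses (h1 : concentrated a1 b1) (h2 : concentrated a2 b2).
Hypotheses (close_re : forall w, - xi <= w <= xi -> `|loc_re a1 b1 w - loc_re a2 b2 w| <= eta).
Hypotheses (close_im : forall w, - xi <= w <= xi -> `|loc_im a1 b1 w - loc_im a2 b2 w| <= eta).

Let a x := a1 x - a2 x.
Let b x := b1 x - b2 x.
Let ra : regular a. Proof. by apply: regularB; [case: h1|case: h2]. Qed.
Let rb : regular b. Proof. by apply: regularB; [case: h1|case: h2]. Qed.

Let mpower (f g : R -> R) : integrable_bounded f -> integrable_bounded g ->
  measurable_fun setT (power_spectrum f g).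
Proof. by move=> [fi _] [gi _]; exact: measurable_power_spectrum. Qed.

Let loc (f : R -> R) x := f x * chi x.
Let rem (f : R -> R) x := f x * (chi x - 1).

Let iloc f : integrable_bounded f -> integrable_bounded (loc f).
Proof. by move=> hf; exact: (integrable_boundedM1 hf mchi chi1). Qed.

Let irem f : integrable_bounded f -> integrable_bounded (rem f).
Proof.
move=> hf; apply: (integrable_boundedM1 hf).
  exact: measurable_funB.
move=> x; rewrite /chi indicE; case: (x \in B).
  by rewrite subrr normr0.
by rewrite sub0r normrN normr1.
Qed.

Let high_le : (\int[mu]_(w in high_freq xi) (power_spectrum a b w)%:E <= (2 * delta + 2 * delta)%:E)%E.
Proof.
case: h1 => -[ia1 _] [ib1 _] f1 _; case: h2 => -[ia2 _] [ib2 _] f2 _.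
case: ra => ia _; case: rb => ib _.
apply: (integral_lincomb_le (g1 := power_spectrum a1 b1) (g2 := power_spectrum a2 b2)) => //.
- by apply: measurableC; exact: measurable_itv.
- exact: mpower.
- exact: mpower.
- exact: mpower.
- by move=> w; exact: power_spectrum_ge0.
- by move=> w; exact: power_spectrum_ge0.
- by move=> w; exact: power_spectrum_ge0.
- by move=> w; exact: power_spectrumB_le.
Qed.

Let outside_le :
  (\int[mu]_(x in log_outside xi) (a x ^+ 2 + b x ^+ 2)%:E <= (2 * delta + 2 * delta)%:E)%E.
Proof.
case: h1 => -[ia1 _] [ib1 _] _ f1; case: h2 => -[ia2 _] [ib2 _] _ f2.
case: ra => ia _; case: rb => ib _.
have msq (f g : R -> R) : integrable_bounded f -> integrable_bounded g ->
    measurable_fun setT (fun x => f x ^+ 2 + g x ^+ 2).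
  by move=> /integrable_bounded_measurable mf /integrable_bounded_measurable mg;
    apply: measurable_funD; exact: measurable_funX.
apply: (integral_lincomb_le (g1 := fun x => a1 x ^+ 2 + b1 x ^+ 2)
  (g2 := fun x => a2 x ^+ 2 + b2 x ^+ 2)) => //.
- by apply: measurableC; exact: mB.
- exact: msq.
- exact: msq.
- exact: msq.
- by move=> x; rewrite addr_ge0 ?sqr_ge0.
- by move=> x; rewrite addr_ge0 ?sqr_ge0.
- by move=> x; rewrite addr_ge0 ?sqr_ge0.
- move=> x; rewrite /a /b.
  have := sqr_ge0 (a1 x + a2 x); have := sqr_ge0 (b1 x + b2 x).
  by rewrite !expr2 => *; lra.
Qed.

Let low : set R := `[- xi, xi]%classic.
Let mlow : measurable low. Proof. exact: measurable_itv. Qed.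

Let rem_le :
  (\int[mu]_(w in low) (power_spectrum (rem a) (rem b) w)%:E <= (2 * delta + 2 * delta)%:E)%E.
Proof.
case: ra => ia _; case: rb => ib _.
have ira := irem ia; have irb := irem ib.
apply: (@le_trans _ _ (\int[mu]_w (power_spectrum (rem a) (rem b) w)%:E)%E).
  apply: ge0_subset_integral => //.
  - by apply/measurable_EFinP; exact: mpower.
  - by move=> w _; rewrite lee_fin power_spectrum_ge0.
apply: le_trans (bessel ira irb) _; rewrite -energyE//.
apply: le_trans _ outside_le; rewrite [leRHS]integral_mkcond.
rewrite le_eqVlt; apply/orP; left; apply/eqP; apply: eq_integral => x _.
rewrite patchE /rem /chi indicE /log_outside -/B in_setC; case: (x \in B) => /=.
  by rewrite subrr !mulr0 expr0n addr0.
by rewrite sub0r !mulrN1 !sqrrN.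
Qed.

Let loc_power_le w : - xi <= w <= xi -> power_spectrum (loc a) (loc b) w <= 2 * eta ^+ 2.
Proof.
move=> wxi; case: h1 => -[ia1 _] [ib1 _] _ _; case: h2 => -[ia2 _] [ib2 _] _ _.
have [[ja1 _] [jb1 _]] := (iloc ia1, iloc ib1).
have [[ja2 _] [jb2 _]] := (iloc ia2, iloc ib2).
have locB (f g : R -> R) : loc (fun x => f x - g x) = (fun x => loc f x - loc g x).
  by apply/funext => x; rewrite /loc mulrBl.
have -> : power_spectrum (loc a) (loc b) w = (loc_re a1 b1 w - loc_re a2 b2 w) ^+ 2 +
    (loc_im a1 b1 w - loc_im a2 b2 w) ^+ 2.
  rewrite /power_spectrum /a /b !locB; congr (_ ^+ 2 + _ ^+ 2).
    exact: re_fourierB.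
  rewrite (_ : (fun x => - _) = (fun x => (- loc a1 x) - (- loc a2 x))); last first.
    by apply/funext => x; ring.
  by apply: re_fourierB => //; [exact: (integrableN ja1)|exact: (integrableN ja2)].
have e0 : 0 <= eta by apply: le_trans (close_re wxi).
rewrite mulr_natl mulr2n; apply: lerD.
  by rewrite -real_normK ?num_real// ler_sqr ?nnegrE//; exact: close_re.
by rewrite -real_normK ?num_real// ler_sqr ?nnegrE//; exact: close_im.
Qed.

Let low_le : (\int[mu]_(w in low) (power_spectrum a b w)%:E <=
  (2 * (4 * xi * eta ^+ 2) + 2 * (2 * delta + 2 * delta))%:E)%E.
Proof.
case: ra => ia _; case: rb => ib _.
have ila := iloc ia; have ilb := iloc ib; have ira := irem ia; have irb := irem ib.
apply: (integral_lincomb_le (g1 := power_spectrum (loc a) (loc b)) (g2 := power_spectrum (rem a) (rem b))) => //.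
- exact: mpower.
- exact: mpower.
- exact: mpower.
- by move=> w; exact: power_spectrum_ge0.
- by move=> w; exact: power_spectrum_ge0.
- by move=> w; exact: power_spectrum_ge0.
- move=> w.
  (* truncation minus remainder, the remainder carrying the factor chi - 1 *)
  have E f : f = (fun x => loc f x - rem f x) by apply/funext => x; rewrite /loc /rem; ring.
  rewrite {1}(E a) {1}(E b).
  exact: power_spectrumB_le.
- apply: (@le_trans _ _ (\int[mu]_(w in low) (2 * eta ^+ 2)%:E)%E).
    apply: ge0_le_integral => //.
    - by move=> w _; rewrite lee_fin power_spectrum_ge0.
    - by apply: measurable_funTS; apply/measurable_EFinP; exact: mpower.
  rewrite integral_cst//= lebesgue_measure_itv/= lte_fin ifT; last by have := xi0; lra.
  rewrite -EFinB -EFinM lee_fin (_ : 2 * eta ^+ 2 * (xi - - xi) = 4 * xi * eta ^+ 2)//.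
  by ring.
Qed.

(** Plancherel, with the frequencies split at xi. *)
Lemma concentrated_close :
  (\int[mu]_x (a x ^+ 2 + b x ^+ 2)%:E <= (8 * xi * eta ^+ 2 + 12 * delta)%:E)%E.
Proof.
case: (ra) => ia _; case: (rb) => ib _.
rewrite energyE//; apply: le_trans (plancherel_le ra rb) _.
have mp : measurable_fun setT (fun w => (power_spectrum a b w)%:E).
  by apply/measurable_EFinP; exact: mpower.
rewrite (ge0_integral_setC mlow mp); last by move=> w; rewrite lee_fin power_spectrum_ge0.
apply: le_trans (leeD low_le high_le) _.
by rewrite -EFinD lee_fin; lra.
Qed.

End splitting.

(** * Finite covers and the conclusion *)

Section concentrated_families.
Variable R : realType.
Notation mu := (@lebesgue_measure R).

Lemma schwartz_regular (f : R -> R[i]) : schwartz_Rpos f ->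
  regular (logre f) /\ regular (logim f).
Proof.
move=> [sre sim]; split; split.
- exact: real_schwartz_integrable_bounded sre.
- exact: real_schwartz_continuous sre.
- exact: real_schwartz_integrable_bounded sim.
- exact: real_schwartz_continuous sim.
Qed.

Lemma schwartz_concentrated (f : L2 R) (xi delta : R) : schwartz_Rpos f ->
  (tail_mass f xi <= delta%:E)%E -> concentrated xi delta (logre f) (logim f).
Proof.
move=> /schwartz_regular[[ia ca] [ib cb]] t; split.
- by split.
- by split.
- exact: le_trans (power_spectrum_tail_le ia ib xi) t.
- exact: le_trans (mass_tail_le ia ib ca cb xi) t.
Qed.

Lemma energy_le_sqr (f : L2 R) (M : R) : integrable_bounded (logre f) ->
  integrable_bounded (logim f) -> (L2norm f <= M%:E)%E ->
  energy (logre f) (logim f) <= M ^+ 2.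
Proof.
move=> ia ib; rewrite -lee_fin -energyE// -L2norm_sqr; last exact: L2_measurable.
have : (0 <= L2norm f)%E by exact: Lnorm_ge0.
case: (L2norm f) => [r|//|//]; rewrite !lee_fin => r0 rM.
by rewrite powR_mulrn// ler_sqr ?nnegrE// (le_trans r0).
Qed.

(** A single constant serves as uniform bound and as Lipschitz constant; it
    depends on xi and on the energy bound only. *)
Lemma loc_bounds (a b : R -> R) (xi M : R) : 1 < xi -> 
  integrable_bounded a -> integrable_bounded b -> energy a b <= M ->
  let chi : R -> R := \1_[set x : R | xi^-1 <= expR x <= xi] in
  let C := (1 + 2 * pi * ln xi) * (\int[mu]_x chi x + M) in
  (forall w, `|loc_re xi a b w| <= C) /\
  (forall w w', `|loc_re xi a b w - loc_re xi a b w'| <= C * `|w - w'|) /\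
  (forall w, `|loc_im xi a b w| <= C) /\
  (forall w w', `|loc_im xi a b w - loc_im xi a b w'| <= C * `|w - w'|).
Proof.
move=> xi1 ia ib eM chi C.
have l0 : 0 < ln xi by rewrite ln_gt0.
have ichi : mu.-integrable setT (EFin \o chi) := integrable_chi xi1.
have mchi : measurable_fun setT chi.
  by apply/measurable_EFinP; case/integrableP : ichi.
have chi1 x : `|chi x| <= 1.
  by rewrite /chi indicE; case: (x \in _); rewrite ?normr1// normr0.
have supp x : ln xi < `|x| -> chi x = 0.
  move=> lx; rewrite /chi (log_boxE xi1) indicE memNset//= in_itv/= => /andP[x1 x2].
  by move: lx; rewrite ltNge ler_norml x1 x2.
have A := integrable_boundedM1 ia mchi chi1; have B := integrable_boundedM1 ib mchi chi1.
have NA := integrable_boundedN A.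
case: (A) => iA _; case: (B) => iB _; case: (NA) => iNA _.
have D1 : \int[mu]_x (`|a x * chi x| + `|b x * chi x|) <= \int[mu]_x chi x + M.
  by apply: Rintegral_norm_localized => //; exact: measurable_log_box.
have D2 : \int[mu]_x (`|b x * chi x| + `|- (a x * chi x)|) <= \int[mu]_x chi x + M.
  by under eq_Rintegral do rewrite normrN addrC.
have D0 : 0 <= \int[mu]_x chi x + M.
  by apply: le_trans D1; apply: Rintegral_ge0 => x _; rewrite addr_ge0.
have pl : 0 <= 2 * pi * ln xi by rewrite !mulr_ge0 ?pi_ge0// ltW.
have C1 : \int[mu]_x chi x + M <= C by rewrite /C mulrDl mul1r lerDl mulr_ge0.
have C2 : 2 * pi * ln xi * (\int[mu]_x chi x + M) <= C by rewrite /C [leRHS]mulrDl mul1r lerDr.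
split; [|split; [|split]].
- move=> w; apply: le_trans (normr_re_fourier_le iA iB w) _; exact: le_trans D1 C1.
- move=> w w'; apply: le_trans (re_fourier_lipschitz w w' (ltW l0) iA iB _) _.
    by move=> x /supp ->; rewrite !mulr0.
  by apply: ler_wpM2r => //; apply: le_trans C2; exact: ler_wpM2l.
- move=> w; apply: le_trans (normr_re_fourier_le iB iNA w) _; exact: le_trans D2 C1.
- move=> w w'; apply: le_trans (re_fourier_lipschitz w w' (ltW l0) iB iNA _) _.
    by move=> x /supp ->; rewrite !mulr0 oppr0.
  by apply: ler_wpM2r => //; apply: le_trans C2; exact: ler_wpM2l.
Qed.

(** One representative of each code that occurs serves as a centre. *)
Lemma cover_of_code (K : set (L2 R)) (e : R) (T : finType) (code : L2 R -> T) :
  (forall f g, K f -> K g -> code f = code g -> L2_ball f e g) ->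
  exists (T : finType) (c : T -> L2 R), forall f, K f -> exists t, L2_ball (c t) e f.
Proof.
move=> codeP; have [[f0 Kf0]|nK] := pselect (exists f, K f); last first.
  exists void, (fun v : void => match v with end) => f Kf.
  by case: nK; exists f.
exists T, (fun t => xget f0 [set f | K f /\ code f = t]) => f Kf.
exists (code f); have [Kg cg] := @xgetPex _ f0 [set g | K g /\ code g = code f]
  (ex_intro _ f (conj Kf erefl)).
exact: codeP.
Qed.

Lemma concentrated_cover (K : set (L2 R)) (M : R) :
  (forall f, K f -> energy (logre f) (logim f) <= M) ->
  (forall delta : R, 0 < delta -> exists xi, 1 < xi /\
    forall f, K f -> concentrated xi delta (logre f) (logim f)) ->
  forall e : R, 0 < e -> exists (T : finType) (c : T -> L2 R),
     forall f, K f -> exists t, L2_ball (c t) e f.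
Proof.
move=> KM Kc e e0.
(* 12 * (e^2 / 24) and 8 * xi * eta^2 are each at most e^2 / 2, the second
   one strictly *)
have [|xi [xi1 Kxi]] := Kc (e ^+ 2 / 24); first by rewrite divr_gt0 ?exprn_gt0.
have xi0 : 0 < xi := lt_trans ltr01 xi1.
pose eta := e / (4 * xi).
have eta0 : 0 < eta by rewrite divr_gt0 ?mulr_gt0.
pose chi : R -> R := \1_[set x : R | xi^-1 <= expR x <= xi].
pose C0 := (1 + 2 * pi * ln xi) * (\int[mu]_x chi x + M).
(* enlarged so as to be positive without a case analysis *)
pose C := `|C0| + 1.
have Cpos : 0 < C by rewrite ltr_wpDl.
have C0C : C0 <= C by rewrite (le_trans (ler_norm _))// lerDl.
have bd f (Kf : K f) := loc_bounds xi1 (concentrated_re (Kxi f Kf)).1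
  (concentrated_im (Kxi f Kf)).1 (KM f Kf).
have [T1 [c1 c1P]] := @equilipschitz_code R (L2 R) K
  (fun f => loc_re xi (logre f) (logim f)) xi C eta xi0 Cpos eta0
  (fun f w Kf => le_trans ((bd f Kf).1 w) C0C)
  (fun f w w' Kf => le_trans ((bd f Kf).2.1 w w') (ler_wpM2r (normr_ge0 _) C0C)).
have [T2 [c2 c2P]] := @equilipschitz_code R (L2 R) K
  (fun f => loc_im xi (logre f) (logim f)) xi C eta xi0 Cpos eta0
  (fun f w Kf => le_trans ((bd f Kf).2.2.1 w) C0C)
  (fun f w w' Kf => le_trans ((bd f Kf).2.2.2 w w') (ler_wpM2r (normr_ge0 _) C0C)).
apply: (@cover_of_code _ _ (T1 * T2)%type (fun f => (c1 f, c2 f))) => f g Kf Kg [fg1 fg2].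
rewrite L2_ballE// /dist2.
apply: le_lt_trans (concentrated_close xi1 (Kxi f Kf) (Kxi g Kg)
  (c1P f g Kf Kg fg1) (c2P f g Kf Kg fg2)) _.
rewrite lte_fin /eta.
have xe : 8 * xi * (e / (4 * xi)) ^+ 2 <= e ^+ 2 * 2^-1 * xi^-1.
  by rewrite le_eqVlt; apply/orP; left; apply/eqP; field; rewrite gt_eqF.
have e2 : 0 < e ^+ 2 by rewrite exprn_gt0.
have : e ^+ 2 * 2^-1 * xi^-1 < e ^+ 2 * 2^-1.
  by rewrite gtr_pMr ?mulr_gt0// invf_lt1.
by lra.
Qed.

End concentrated_families.

Theorem corollary4p6 (R : realType) (K : set (L2 R))
  (K_schwartz : forall f : L2 R, K f -> schwartz_Rpos f)
  (K_bounded : exists M : R, forall f : L2 R, K f -> (L2norm f <= M%:E)%E)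
  (K_tails : sup_tail_mass K xi @[xi --> +oo] --> 0%E) :
  precompact K.
Proof.
have [M KM] := K_bounded.
apply: totally_bounded_precompact; apply: (@concentrated_cover R K (M ^+ 2)).
  move=> f Kf; have [[ia _] [ib _]] := schwartz_regular (K_schwartz f Kf).
  by apply: energy_le_sqr => //; exact: KM.
move=> delta delta0.
have small : \forall xi \near +oo, (sup_tail_mass K xi < delta%:E)%E.
  have d0 : open_nbhs 0%E [set y : \bar R | (y < delta%:E)%E].
    by split; [exact: open_ereal_lt_ereal|rewrite /= lte_fin].
  exact: (K_tails _ (open_nbhs_nbhs d0)).
have large : \forall xi \near +oo, (1 : R) < xi by apply: nbhs_pinfty_gt; rewrite num_real.
have [xi [xi_small xi1]] := @filter_ex _ _ _ _ (filterI small large).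
exists xi; split => // f Kf; apply: schwartz_concentrated; first exact: K_schwartz.
apply: le_trans (ltW xi_small); rewrite /sup_tail_mass le_max; apply/orP; right.
by apply: ereal_sup_ubound; exists f.
Qed.
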